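(* Let $X$ be a real Banach space and let $T_1,T_2:X\rightrightarrows X^*$ be maximal monotone operators of type (D). Then their variational sum $T_1\mathop{+}_v T_2$ is representable.
   Context: Operators are identified with their graphs. For a maximal monotone $T:X\rightrightarrows X^*$, $\widetilde T=\{(x^{**},x^* )\in X^{**}\times X^*: \langle x^{**}-y, x^*-y^*\rangle\ge 0 \text{ for all }(y,y^* )\in T\}$. $T$ is of type (D) if every $(x^{**},x^* )\in\widetilde T$ is the weak$^*\times$strong limit of a bounded net in $T$. A monotone operator $T$ is representable if there is a convex, proper, lower semicontinuous $h:X\times X^*\to\mathbb{R}\cup\{+\infty\}$ with $h(x,x^* )\ge\langle x,x^*\rangle$ for all $(x,x^* )$ and $T=\{(x,x^* ): h(x,x^* )=\langle x,x^*\rangle\}$. With $J=\partial\frac12\|\cdot\|^2$, for $T$ of type (D) and $\lambda>0$ the Moreau-Yosida regularization is $T_\lambda=\{(x,x^* ): \exists\, z^{**}\in X^{**} \text{ with } x^*\in\widetilde T(z^{**}),\ 0\in\lambda x^*+\widetilde J(z^{**}-x)\}$, and $T_0=T$. The sequential lower limit of operators $S_n:X\rightrightarrows X^*$ is $\liminf S_n=\{(x,x^* ): \exists\,(y_n,y_n^* )\in S_n \text{ with } (y_n,y_n^* )\to(x,x^* ) \text{ in the strong}\times\text{strong topology}\}$. Let $\mathcal{I}=\{(\lambda_n,\mu_n)_n\subset\mathbb{R}^2: \lambda_n,\mu_n\ge 0,\ \lambda_n+\mu_n>0,\ \lambda_n,\mu_n\to 0\}$. The variational sum is $T_1\mathop{+}_v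 T_2=\bigcap_{\mathcal{I}}\liminf_n (T_{1,\lambda_n}+T_{2,\mu_n})$. *)

(* Defs.v *)
From HB Require Import structures.
From mathcomp Require Import all_boot all_order all_algebra.
From mathcomp Require Import all_classical all_reals all_analysis.
Import Order.TTheory GRing.Theory Num.Theory.
Import numFieldNormedType.Exports.
Local Open Scope classical_set_scope.
Local Open Scope ring_scope.

Section MonotoneDefs.
Context {R : realType} {X : normedModType R}.

(* Elements of X^* are represented as functions X -> R that are linear and
   continuous. *)
Definition is_dual (f : X -> R) : Prop :=
  (forall (a : R) (x y : X), f (a *: x + y) = a * f x + f y) /\ continuous f.

Definition dnorm (f : X -> R) : R :=
  sup [set `|f x| | x in [set x : X | `|x| <= 1]].

(* Elements of X^** are represented as functions (X -> R) -> R that are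
   linear and bounded on X^* (only their values on X^* matter). *)
Definition is_bidual (phi : (X -> R) -> R) : Prop :=
  (forall (a : R) (f g : X -> R), is_dual f -> is_dual g ->
     phi (fun x => a * f x + g x) = a * phi f + phi g) /\
  exists C : R, forall f, is_dual f -> `|phi f| <= C * dnorm f.

Definition embed (x : X) : (X -> R) -> R := fun f => f x.

(* Operators X ⇉ X^* identified with their graphs *)
Definition opX := set (X * (X -> R)).

Definition dual_op (T : opX) : Prop := forall p, T p -> is_dual p.2.

Definition monotone_op (T : opX) : Prop :=
  dual_op T /\
  forall x f y g, T (x, f) -> T (y, g) -> 0 <= f (x - y) - g (x - y).

Definition maximal_monotone (T : opX) : Prop :=
  monotone_op T /\ forall S : opX, monotone_op S -> T `<=` S -> S = T.

Definition tilde (T : opX) : set (((X -> R) -> R) * (X -> R)) :=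
  [set p | is_bidual p.1 /\ is_dual p.2 /\
     forall y g, T (y, g) ->
       0 <= p.1 (fun z => p.2 z - g z) - (p.2 y - g y)].

Definition directed (I : Type) (le : I -> I -> Prop) : Prop :=
  (exists i : I, True) /\ (forall i, le i i) /\
  (forall i j k, le i j -> le j k -> le i k) /\
  (forall i j, exists k, le i k /\ le j k).

Definition net_cvg (I : Type) (le : I -> I -> Prop) (a : I -> R) (l : R)
  : Prop :=
  forall e : R, 0 < e -> exists i0, forall i, le i0 i -> `|a i - l| < e.

Arguments directed {I}.
Arguments net_cvg {I}.

Definition typeD (T : opX) : Prop :=
  maximal_monotone T /\
  forall phi f, tilde T (phi, f) ->
    exists (I : Type) (le : I -> I -> Prop) (x : I -> X) (g : I -> X -> R),
      directed le /\ (forall i, T (x i, g i)) /\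
      (exists M : R, forall i, `|x i| <= M /\ dnorm (g i) <= M) /\
      (forall h, is_dual h -> net_cvg le (fun i => h (x i)) (phi h)) /\
      net_cvg le (fun i => dnorm (fun z => g i z - f z)) 0.

Definition subdiff (F : X -> R) : opX :=
  [set p | is_dual p.2 /\ forall y, F p.1 + p.2 (y - p.1) <= F y].

Definition Jdual : opX := subdiff (fun x => 2^-1 * `|x| ^+ 2).

Definition moreau_yosida (T : opX) (l : R) : opX :=
  [set p | is_dual p.2 /\ exists z, is_bidual z /\ tilde T (z, p.2) /\
     tilde Jdual ((fun h => z h - h p.1), (fun x => - (l * p.2 x)))].

Definition reg (T : opX) (l : R) : opX :=
  [set p | (l = 0 /\ T p) \/ (0 < l /\ moreau_yosida T l p)].

Definition opsum (S1 S2 : opX) : opX :=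
  [set p | exists f1 f2, S1 (p.1, f1) /\ S2 (p.1, f2) /\
     p.2 = (fun x => f1 x + f2 x)].

Definition liminf_op (S : nat -> opX) : opX :=
  [set p | is_dual p.2 /\ exists (y : nat -> X) (g : nat -> X -> R),
     (forall n, S n (y n, g n)) /\ y @ \oo --> p.1 /\
     (fun n => dnorm (fun z => g n z - p.2 z)) @ \oo --> (0 : R)].

Definition admissible (l m : nat -> R) : Prop :=
  (forall n, 0 <= l n /\ 0 <= m n /\ 0 < l n + m n) /\
  l @ \oo --> (0 : R) /\ m @ \oo --> (0 : R).

Definition var_sum (T1 T2 : opX) : opX :=
  [set p | forall l m, admissible l m ->
     liminf_op (fun n => opsum (reg T1 (l n)) (reg T2 (m n))) p].

Definition representable (T : opX) : Prop :=
  exists h : X * (X -> R) -> \bar R,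
    (forall p, is_dual p.2 -> h p != -oo%E) /\
    (exists p, is_dual p.2 /\ (h p < +oo)%E) /\
    (forall (x1 : X) f1 (x2 : X) f2 (t : R), is_dual f1 -> is_dual f2 -> 0 < t < 1 ->
       (h ((t *: x1 + (1 - t) *: x2)%R, fun z => (t * f1 z + (1 - t) * f2 z)%R)
        <= t%:E * h (x1, f1) + (1 - t)%R%:E * h (x2, f2))%E) /\
    (forall x f, is_dual f -> forall t : R, (t%:E < h (x, f))%E ->
       exists d : R, 0 < d /\ forall y g, is_dual g -> `|y - x| < d ->
         dnorm (fun z => g z - f z) < d -> (t%:E < h (y, g))%E) /\
    (forall x f, is_dual f -> ((f x)%:E <= h (x, f))%E) /\
    T = [set p | is_dual p.2 /\ h p = (p.2 p.1)%:E].

End MonotoneDefs.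

(* Main.v *)
Require Import Defs.
From HB Require Import structures.
From mathcomp Require Import all_boot all_order all_algebra.
From mathcomp Require Import all_classical all_reals all_analysis.
From mathcomp Require Import ring lra.
Import Order.TTheory GRing.Theory Num.Theory.
Import numFieldNormedType.Exports.
Local Open Scope classical_set_scope.
Local Open Scope ring_scope.

(* For [l >= 0] the operator [reg T l] is represented by
     inf_z [ F(z, a) + |y - z|^2 / (2 l) + l |a|^2 / 2 ],
   where [F] is the Fitzpatrick function of [T] on [X^** * X^*], and the sum
   [reg T1 l + reg T2 m] by the partial inf-convolution [H] of two such functions.
   Type (D) gives [F >= pairing] on [X^** * X^*]; by Hahn-Banach this yields
     inf_(y, g) [ H(y, g) - g x - f y + f x + |y - x|^2 / 2 + |g - f|^2 / 2 ] <= 0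
   for every [(x, f)] as soon as [l + m > 0].  Iterating this estimate, a point where
   [H - pairing <= e^2] is at distance at most [6 e] from a point [(y, g)] with
   [H(y, g) = g y] (weak* compactness makes [H] closed), and such a [(y, g)] belongs
   to the sum.  Hence the upper epi-limits of the functions [H] along admissible
   sequences, and then their supremum, represent the variational sum.
   Applied to the function [|y|^2 / 2 + |g|^2 / 2], the same estimate is the
   Bishop-Phelps-Bollobas theorem; it shows that the elements of [tilde Jdual] are
   subgradients of the dual quadratic, which is needed to see that the graph of
   [reg T l] lies in the contact set of its representative. *)

(** The variational sum is a lower limit of contact sets, and such a limit is in general smaller
    than the contact set of the epi-limit. The two agree here because the displacement [6 e] for a
    gap [e^2] does not depend on [l] and [m], so the estimate survives when both tend to 0. The
    condition [l + m > 0] acts as the qualification for the sum. A positive parameter lets the two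
    Fitzpatrick functions be evaluated at different first arguments at a finite cost, so that
    Hahn-Banach meets a finite convex function. It also bounds [a1] and [a2] separately when only
    [a1 + a2] is known to be bounded, which gives compactness. Since [X] need not be reflexive,
    infima are attained only in [X^**], while points of the sum have their base point in [X]. Hence
    minimization is carried out approximately over [X], and [X^**] enters through the separating
    functional and through limits. All functions are handled through relations saying that the value
    is at most [c], with affine certificates; these pass to generalized limits and spare extended
    reals until the very end. *)

(** * Hahn-Banach theorem and separation of convex functions *)

Section HahnBanach.
Context {R : realType} {V : lmodType R}.

Definition sublinear (q : V -> R) : Prop :=
  (forall x y, q (x + y) <= q x + q y) /\
  (forall (t : R) x, 0 < t -> q (t *: x) = t * q x).

Lemma sublinear0 (q : V -> R) : sublinear q -> q 0 = 0.
Proof. by move=> [_ qZ]; have := qZ 2 0 ltac:(lra); rewrite scaler0; lra. Qed.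

(** An element of [A (- v)] bounds [A v] from below, because its sum with any element of [A v]
    dominates an element of [A 0]; so the pointwise infimum is finite. Every sublinear functional
    constructed below arises in this way. *)
Lemma sublinear_inf (A : V -> set R) :
  (forall v, A v !=set0) ->
  (forall v c v' c', A v c -> A v' c' ->
     exists2 c'', A (v + v') c'' & c'' <= c + c') ->
  (forall (t : R) v c, 0 < t -> A v c -> A (t *: v) (t * c)) ->
  (forall c, A 0 c -> 0 <= c) ->
  exists2 p, sublinear p & forall v c, A v c -> p v <= c.
Proof.
move=> A0 AD AZ Age0.
have infA v : has_inf (A v).
  split=> //; have [c Ac] := A0 (- v); exists (- c) => b Ab.
  have [e Ae le] := AD _ _ _ _ Ab Ac.
  by move: Ae; rewrite subrr => /Age0; lra.
have leA v c : A v c -> inf (A v) <= c by apply: ge_inf; case: (infA v).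
have pZ (t : R) v : 0 < t -> inf (A (t *: v)) <= t * inf (A v).
  move=> t0; rewrite -ler_pdivrMl//; apply: lb_le_inf => // c Ac.
  by rewrite ler_pdivrMl//; apply: leA; exact: AZ.
exists (fun v => inf (A v)) => //; split=> [x y|t x t0].
  apply/ler_addgt0Pr => e e0; have e2 : 0 < e / 2 by lra.
  have [c Ac cx] := inf_adherent e2 (infA x).
  have [c' Ac' cy] := inf_adherent e2 (infA y).
  have [c'' /leA + ?] := AD _ _ _ _ Ac Ac'; lra.
apply/eqP; rewrite eq_le pZ//= -ler_pdivlMl//.
have := pZ t^-1 (t *: x); rewrite invr_gt0 => /(_ t0).
by rewrite scalerA mulVf ?scale1r ?gt_eqF.
Qed.

(** Zorn's lemma is applied to the sublinear functionals below [p], instead of to partial linear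
    extensions: a minimal one is linear. *)
Theorem hahn_banach (p : V -> R) : sublinear p ->
  exists2 l : V -> R, (forall a u v, l (a *: u + v) = a * l u + l v) &
    forall v, l v <= p v.
Proof.
move=> sp; pose S := {q : V -> R | sublinear q /\ forall v, q v <= p v}.
pose leS (q1 q2 : S) := `[< forall v, sval q2 v <= sval q1 v >].
have [||||[q [sq qp]] qmin] := @Zorn S leS.
- by move=> q; apply/asboolP.
- by move=> q r s /asboolP qr /asboolP rs; apply/asboolP => v; exact: le_trans (rs v) (qr v).
- move=> [q Hq] [r Hr] /asboolP /= qr /asboolP /= rq; apply: eq_exist.
  by apply/funext => v; apply/le_anti; rewrite qr rq.
- move=> A Atot; have [[q0 Aq0]|Aempty] := pselect (exists q, A q); last first.
    by exists (exist _ p (conj sp (fun v => lexx (p v)))) => q Aq; case: Aempty; exists q.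
  pose B v c := exists2 q, A q & c = sval q v.
  have [||||m sm mB] := @sublinear_inf B.
  + by move=> v; exists (sval q0 v), q0.
  + move=> v c v' c' [q Aq ->] [q' Aq' ->].
    case: (Atot _ _ Aq Aq') => /asboolP qq'.
    * exists (sval q' (v + v')); first by exists q'.
      case: (svalP q') => -[q'D _] _; exact: le_trans (q'D _ _) (lerD (qq' _) (lexx _)).
    * exists (sval q (v + v')); first by exists q.
      case: (svalP q) => -[qD _] _; exact: le_trans (qD _ _) (lerD (lexx _) (qq' _)).
  + by move=> t v c t0 [q Aq ->]; exists q => //; case: (svalP q) => -[_ qZ] _; rewrite qZ.
  + by move=> c [q _ ->]; case: (svalP q) => sq _; rewrite sublinear0.
  have mp v : m v <= p v.
    apply: (@le_trans _ _ (sval q0 v)); first by apply: mB; exists q0.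
    by case: (svalP q0).
  exists (exist _ m (conj sm mp)) => q Aq; apply/asboolP => v /=.
  by apply: mB; exists q.
have [qD qZ] := sq.
have qadd x v : q (x + v) = q x + q v.
  apply/eqP; rewrite eq_le qD /=.
  (* The infimum over [t] is a sublinear minorant of [q], hence equal to [q] by minimality; the
     value at [t = 1] is then the missing superadditivity. *)
  pose B x c := exists2 t : R, 0 <= t & c = q (x + t *: v) - t * q v.
  have [||||m sm mB] := @sublinear_inf B.
  - by move=> y; exists (q (y + 0 *: v) - 0 * q v), 0.
  - move=> y c y' c' [t t0 ->] [t' t0' ->].
    exists (q (y + y' + (t + t') *: v) - (t + t') * q v).
      by exists (t + t') => //; exact: addr_ge0.
    have := qD (y + t *: v) (y' + t' *: v).
    by rewrite addrACA -scalerDl; lra.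
  - move=> s y c s0 [t t0 ->]; exists (s * t); first exact: mulr_ge0 (ltW s0) t0.
    by rewrite mulrBr -(qZ s (y + _))// scalerDr scalerA mulrA.
  - move=> c [t + ->]; rewrite add0r le_eqVlt => /predU1P[<-|t0].
      by rewrite scale0r sublinear0//; lra.
    by rewrite qZ// subrr.
  have mq y : m y <= q y.
    by apply: mB; exists 0 => //; rewrite scale0r addr0 mul0r subr0.
  pose mS : S := exist _ m (conj sm (fun y => le_trans (mq y) (qp y))).
  have /(congr1 sval) /= mE := qmin mS ltac:(apply/asboolP; exact: mq).
  have : m x <= q (x + 1 *: v) - 1 * q v by apply: mB; exists 1.
  by rewrite mE scale1r; lra.
exists q => // a u v; rewrite qadd; congr (_ + _).
have qN x : q (- x) = - q x.
  by have := qadd x (- x); rewrite subrr sublinear0//; lra.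
have [a0|a0|a0] := ltgtP 0 a; first exact: qZ.
  by rewrite -[a]opprK scaleNr qN qZ ?mulNr// oppr_gt0.
by rewrite -a0 scale0r mul0r sublinear0.
Qed.

(** An extended-valued function is encoded by a relation: [E w r] bounds the value at [w] by [r],
    and a point related to no [r] has value [+oo]. *)
Definition convex_epi (E : V -> R -> Prop) : Prop :=
  forall w r w' r' (t : R), 0 < t < 1 -> E w r -> E w' r' ->
    E (t *: w + (1 - t) *: w') (t * r + (1 - t) * r').

(** Hahn-Banach is applied to the infimum of [s (r + r' - d)] over all representations
    [v = s (w - w')]. At [v = 0] one has [w = w'], so these numbers are nonnegative by hypothesis;
    totality of [G] provides a representation of each [v]. *)
Lemma convex_sandwich (E G : V -> R -> Prop) (d : R) :
  convex_epi E -> convex_epi G -> (exists w r, E w r) ->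
  (forall v, exists r, G v r) ->
  (forall w r r', E w r -> G w r' -> d <= r + r') ->
  exists2 l : V -> R, (forall a u v, l (a *: u + v) = a * l u + l v) &
    forall w r s r', E w r -> G s r' -> l w - l s + d <= r + r'.
Proof.
move=> cE cG [w0 [r0 E0]] Gtot EG.
pose A v c := exists w r w' r' (s : R), [/\ 0 < s, E w r, G w' r',
  v = s *: (w - w') & c = s * (r + r' - d)].
have [||||p sp pA] := @sublinear_inf A.
- move=> v; have [r' Gr] := Gtot (w0 - v); exists (r0 + r' - d).
  exists w0, r0, (w0 - v), r', 1; split=> //.
  + by rewrite scale1r opprB addrC subrK.
  + by rewrite mul1r.
- move=> v c v' c' [w [r [w' [r' [s [s0 Ew Gw -> ->]]]]]].
  move=> [z [q [z' [q' [t [t0 Ez Gz -> ->]]]]]].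
  have st0 : s + t != 0 by rewrite gt_eqF ?addr_gt0.
  pose k := s / (s + t).
  have k01 : 0 < k < 1.
    by rewrite divr_gt0 ?addr_gt0//= ltr_pdivrMr ?addr_gt0//; lra.
  have sk : (s + t) * k = s by rewrite mulrC divfK.
  have tk : (s + t) * (1 - k) = t by rewrite mulrBr sk; lra.
  exists (s * (r + r' - d) + t * (q + q' - d)) => //.
  exists (k *: w + (1 - k) *: z), (k * r + (1 - k) * q),
    (k *: w' + (1 - k) *: z'), (k * r' + (1 - k) * q'), (s + t).
  split; [exact: addr_gt0|exact: cE|exact: cG| |].
  + by rewrite opprD addrACA -!scalerBr [RHS]scalerDr !scalerA sk tk.
  + transitivity ((s + t) * k * (r + r' - d) + (s + t) * (1 - k) * (q + q' - d)).
      by rewrite sk tk.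
    by clearbody k; ring.
- move=> t v c t0 [w [r [w' [r' [s [s0 Ew Gw -> ->]]]]]].
  exists w, r, w', r', (t * s); split=> //; first exact: mulr_gt0.
    by rewrite scalerA.
  by rewrite mulrA.
- move=> c [w [r [w' [r' [s [s0 Ew Gw /eqP + ->]]]]]].
  rewrite eq_sym scaler_eq0 gt_eqF//= subr_eq0 => /eqP ww'; subst w'.
  by apply: mulr_ge0; [exact: ltW|rewrite subr_ge0; exact: EG Ew Gw].
have [l ladd lp] := hahn_banach p sp; exists l => // w r s r' Ew Gs.
have /(le_trans (lp _)) : p (w - s) <= r + r' - d.
  apply: pA; exists w, r, s, r', 1; rewrite mul1r scale1r; split=> //.
have := ladd (-1) s w; rewrite scaleN1r [- s + w]addrC => ->; lra.
Qed.

End HahnBanach.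

(** * Continuous functionals, the dual norm and the bidual *)

Section Dual.
Context {R : realType} {X : normedModType R}.
Implicit Types (f g h : X -> R) (x y : X) (z w : (X -> R) -> R).

Lemma dual_bounded f : is_dual f ->
  exists2 C, 0 <= C & forall x, `|f x| <= C * `|x|.
Proof.
move=> [flin fcont].
have f0 : f 0 = 0 by have := flin 1 0 0; rewrite scale1r addr0; lra.
have /cvgrPdist_lt /(_ 1 ltr01) := fcont 0.
rewrite -nbhs_nearE => /nbhs_ballP[e /= e0 fe].
exists (2 / e); first by rewrite divr_ge0 ?ltW.
move=> x; have [->|x0] := eqVneq x 0; first by rewrite f0 !normr0 mulr0.
have nx : 0 < `|x| by rewrite normr_gt0.
pose k := e / (2 * `|x|).
have k0 : 0 < k by rewrite divr_gt0// mulr_gt0.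
have fk : f (k *: x) = k * f x.
  by have := flin k x 0; rewrite addr0 f0 addr0.
have kx : k * `|x| = e / 2 by rewrite /k; field; rewrite gt_eqF.
have /fe /= : ball 0 e (k *: x).
  by rewrite -ball_normE /= sub0r normrN normrZ gtr0_norm// kx; lra.
rewrite f0 sub0r normrN fk normrM gtr0_norm//.
rewrite -ltr_pdivlMl// mulr1 => /ltW /le_trans; apply.
by rewrite /k invf_div mulrAC.
Qed.

Lemma dual_of_bound (C : R) f :
  (forall (a : R) x y, f (a *: x + y) = a * f x + f y) ->
  (forall x, `|f x| <= C * `|x|) -> is_dual f.
Proof.
move=> flin fC; split=> // x; apply/cvgrPdist_lt => e e0.
have C1 : 0 < `|C| + 1 by rewrite ltr_wpDl.
rewrite -nbhs_nearE; apply/nbhs_ballP; exists (e / (`|C| + 1)) => /=; first exact: divr_gt0.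
move=> y; rewrite -ball_normE /= ltr_pdivlMr// => xy.
have -> : f x - f y = f (x - y).
  by have := flin (-1) y x; rewrite scaleN1r addrC => ->; lra.
apply: le_lt_trans (fC _) _; apply: le_lt_trans xy; rewrite mulrC.
apply: ler_wpM2l => //; have := ler_norm C; lra.
Qed.

Lemma dualD f x y : is_dual f -> f (x + y) = f x + f y.
Proof. by move=> [fl _]; have := fl 1 x y; rewrite scale1r mul1r. Qed.

Lemma dual0 f : is_dual f -> f 0 = 0.
Proof. by move=> fd; have := dualD f 0 0 fd; rewrite addr0; lra. Qed.

Lemma dualZ f (a : R) x : is_dual f -> f (a *: x) = a * f x.
Proof. by move=> fd; have := fd.1 a x 0; rewrite !addr0 dual0// addr0. Qed.

Lemma dualN f x : is_dual f -> f (- x) = - f x.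
Proof. by move=> fd; rewrite -scaleN1r dualZ// mulN1r. Qed.

Lemma dualB f x y : is_dual f -> f (x - y) = f x - f y.
Proof. by move=> fd; rewrite dualD// dualN. Qed.

Lemma dnorm_has_sup f : is_dual f ->
  has_sup [set `|f x| | x in [set x : X | `|x| <= 1]].
Proof.
move=> fd; split; first by exists `|f 0|, 0 => //=; rewrite normr0 ler01.
have [C C0 fC] := dual_bounded f fd.
exists C => _ [x /= x1 <-]; apply: le_trans (fC x) _.
by rewrite -[leRHS]mulr1; exact: ler_wpM2l.
Qed.

Lemma dual_norm_ge0 f : is_dual f -> 0 <= dnorm f.
Proof.
move=> fd; apply: le_trans (normr_ge0 (f 0)) _.
apply: ub_le_sup; first by case: (dnorm_has_sup f fd).
by exists 0 => //=; rewrite normr0 ler01.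
Qed.

Lemma dnorm_bound f x : is_dual f -> `|f x| <= dnorm f * `|x|.
Proof.
move=> fd; have [->|x0] := eqVneq x 0.
  by rewrite dual0// !normr0 mulr0.
have nx : 0 < `|x| by rewrite normr_gt0.
rewrite -ler_pdivrMr//.
have -> : `|f x| / `|x| = `|f (`|x|^-1 *: x)|.
  by rewrite dualZ// normrM ger0_norm ?invr_ge0// mulrC.
apply: ub_le_sup; first by case: (dnorm_has_sup f fd).
exists (`|x|^-1 *: x) => //=.
by rewrite normrZ ger0_norm ?invr_ge0// mulVf ?gt_eqF.
Qed.

Lemma dnorm_bound_le f x : is_dual f -> f x <= dnorm f * `|x|.
Proof. by move=> fd; apply: le_trans (dnorm_bound f x fd); exact: ler_norm. Qed.

Lemma dnorm_le f (C : R) : 0 <= C -> (forall x, `|f x| <= C * `|x|) -> dnorm f <= C.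
Proof.
move=> C0 fC; apply: ge_sup; first by exists `|f 0|, 0 => //=; rewrite normr0 ler01.
move=> _ [x /= x1 <-]; apply: le_trans (fC x) _.
by rewrite -[leRHS]mulr1; exact: ler_wpM2l.
Qed.

Lemma dnorm_adherent f (e : R) : is_dual f -> 0 < e ->
  exists2 x, `|x| <= 1 & dnorm f - e < f x.
Proof.
move=> fd e0; have [_ [x /= x1 <-] fx] := sup_adherent e0 (dnorm_has_sup f fd).
have [fx0|fx0] := leP 0 (f x); first by exists x => //; rewrite ger0_norm in fx.
by exists (- x); [rewrite normrN|rewrite dualN// -(ltr0_norm fx0)].
Qed.

Lemma dual_lincomb (a b : R) f g : is_dual f -> is_dual g ->
  is_dual (fun x => a * f x + b * g x).
Proof.
move=> fd gd; apply: (@dual_of_bound (`|a| * dnorm f + `|b| * dnorm g)).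
  by move=> c x y; rewrite !dualD// !dualZ//; ring.
move=> x; apply: le_trans (ler_normD _ _) _; rewrite mulrDl !normrM -!mulrA.
by apply: lerD; apply: ler_wpM2l => //; exact: dnorm_bound.
Qed.

Lemma dnorm_lincomb (a b : R) f g : is_dual f -> is_dual g ->
  dnorm (fun x => a * f x + b * g x) <= `|a| * dnorm f + `|b| * dnorm g.
Proof.
move=> fd gd; apply: dnorm_le.
  by apply: addr_ge0; apply: mulr_ge0 => //; exact: dual_norm_ge0.
move=> x; apply: le_trans (ler_normD _ _) _; rewrite mulrDl !normrM -!mulrA.
by apply: lerD; apply: ler_wpM2l => //; exact: dnorm_bound.
Qed.

Lemma is_dual0 : is_dual (fun _ : X => 0 : R).
Proof.
by apply: (@dual_of_bound 0) => [a x y|x]; rewrite ?mulr0 ?addr0// normr0 mul0r.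
Qed.

Lemma dual_add f g : is_dual f -> is_dual g -> is_dual (fun x => f x + g x).
Proof.
move=> fd gd; have := dual_lincomb 1 1 f g fd gd.
by under eq_fun do rewrite !mul1r.
Qed.

Lemma dual_sub f g : is_dual f -> is_dual g -> is_dual (fun x => f x - g x).
Proof.
move=> fd gd; have := dual_lincomb 1 (-1) f g fd gd.
by under eq_fun do rewrite mul1r mulN1r.
Qed.

Lemma dual_scale (a : R) f : is_dual f -> is_dual (fun x => a * f x).
Proof.
move=> fd; have := dual_lincomb a 0 f f fd fd.
by under eq_fun do rewrite mul0r addr0.
Qed.

Lemma dual_opp f : is_dual f -> is_dual (fun x => - f x).
Proof.
by move=> /(dual_scale (-1)); under eq_fun do rewrite mulN1r.
Qed.

Lemma dual_normD f g : is_dual f -> is_dual g ->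
  dnorm (fun x => f x + g x) <= dnorm f + dnorm g.
Proof.
move=> fd gd; have := dnorm_lincomb 1 1 f g fd gd.
by under eq_fun do rewrite !mul1r; rewrite normr1 !mul1r.
Qed.

Lemma dual_normB f g : is_dual f -> is_dual g ->
  dnorm (fun x => f x - g x) <= dnorm f + dnorm g.
Proof.
move=> fd gd; have := dnorm_lincomb 1 (-1) f g fd gd.
by under eq_fun do rewrite mul1r mulN1r; rewrite normrN normr1 !mul1r.
Qed.

Lemma dual_normZ_le (a : R) f : is_dual f -> dnorm (fun x => a * f x) <= `|a| * dnorm f.
Proof.
move=> fd; have := dnorm_lincomb a 0 f f fd fd.
by under eq_fun do rewrite mul0r addr0; rewrite normr0 mul0r addr0.
Qed.

Lemma dual_normBC f g : dnorm (fun x => f x - g x) = dnorm (fun x => g x - f x).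
Proof.
by congr sup; apply: eq_imagel => x _; rewrite distrC.
Qed.

Lemma dnorm_triangle f g h : is_dual f -> is_dual g -> is_dual h ->
  dnorm (fun x => f x - h x) <= dnorm (fun x => f x - g x) + dnorm (fun x => g x - h x).
Proof.
move=> fd gd hd; have := dual_normD _ _ (dual_sub f g fd gd) (dual_sub g h gd hd).
by under eq_fun do rewrite addrA subrK.
Qed.

Lemma bidual_lin z (a b : R) f g : is_bidual z -> is_dual f -> is_dual g ->
  z (fun x => a * f x + b * g x) = a * z f + b * z g.
Proof.
move=> [zl _] fd gd; rewrite zl//; last exact: dual_scale.
congr (_ + _); have := zl b g (fun=> 0) gd is_dual0.
have := zl 1 (fun=> 0) (fun=> 0) is_dual0 is_dual0.
under eq_fun do rewrite mulr0 addr0; move=> z0.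
by under eq_fun do rewrite addr0; move=> ->; lra.
Qed.

Lemma bidualB z f g : is_bidual z -> is_dual f -> is_dual g ->
  z (fun x => f x - g x) = z f - z g.
Proof.
move=> zd fd gd; have := bidual_lin z 1 (-1) f g zd fd gd.
by under eq_fun do rewrite mul1r mulN1r; rewrite mul1r mulN1r.
Qed.

Lemma bidualZ z (a : R) f : is_bidual z -> is_dual f -> z (fun x => a * f x) = a * z f.
Proof.
move=> zd fd; have := bidual_lin z a 0 f f zd fd fd.
by under eq_fun do rewrite mul0r addr0; rewrite mul0r addr0.
Qed.

Lemma bidual0 z : is_bidual z -> z (fun=> 0) = 0.
Proof.
move=> zd; have := bidualZ z 0 (fun=> 0) zd is_dual0.
by under eq_fun do rewrite mulr0; rewrite mul0r.
Qed.

Lemma bidualN z f : is_bidual z -> is_dual f -> z (fun x => - f x) = - z f.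
Proof.
move=> zd fd; have := bidualZ z (-1) f zd fd.
by under eq_fun do rewrite mulN1r; rewrite mulN1r.
Qed.

Lemma bidual_lincomb (a b : R) z w : is_bidual z -> is_bidual w ->
  is_bidual (fun f => a * z f + b * w f).
Proof.
move=> zd wd; split=> [c f g fd gd|].
  have zE := bidual_lin z c 1 f g zd fd gd; have wE := bidual_lin w c 1 f g wd fd gd.
  by move: zE wE; under eq_fun do rewrite mul1r; move=> -> ->; ring.
have [_ [C zC]] := zd; have [_ [D wD]] := wd.
exists (`|a| * C + `|b| * D) => f fd.
apply: le_trans (ler_normD _ _) _; rewrite mulrDl !normrM -!mulrA.
by apply: lerD; apply: ler_wpM2l => //; [exact: zC|exact: wD].
Qed.

Lemma embed_bidual x : is_bidual (embed x).
Proof.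
split=> //; exists `|x| => f fd; rewrite mulrC; exact: dnorm_bound.
Qed.

Lemma bidual_sub z w : is_bidual z -> is_bidual w -> is_bidual (fun f => z f - w f).
Proof.
move=> zd wd; have := bidual_lincomb 1 (-1) z w zd wd.
by under eq_fun do rewrite mul1r mulN1r.
Qed.

Lemma bidual_of_unit_bound (C : R) z :
  (forall (a : R) f g, is_dual f -> is_dual g ->
     z (fun x => a * f x + g x) = a * z f + z g) ->
  (forall f, is_dual f -> dnorm f <= 1 -> z f <= C) -> is_bidual z.
Proof.
move=> zl zC; split=> //.
have zZ (a : R) f : is_dual f -> z (fun x => a * f x) = a * z f.
  move=> fd; have := zl 1 _ _ is_dual0 is_dual0.
  under eq_fun do rewrite mulr0 addr0; move=> z0.
  have := zl a f (fun=> 0) fd is_dual0.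
  by under eq_fun do rewrite addr0; move=> ->; lra.
have C0 : 0 <= C.
  have := zC (fun=> 0) is_dual0; have := zZ 0 _ is_dual0.
  under eq_fun do rewrite mul0r; rewrite mul0r => ->; apply.
  by apply: dnorm_le => // x; rewrite normr0 mul1r.
have zle f : is_dual f -> z f <= C * dnorm f.
  move=> fd; have n0 := dual_norm_ge0 f fd; apply/ler_addgt0Pr => e e0.
  (* The added term keeps [k] positive when [dnorm f = 0], and costs at most [e] after
     multiplication by [C]. *)
  pose k := dnorm f + e / (C + 1).
  have ek : 0 < e / (C + 1) by rewrite divr_gt0//; lra.
  have k0 : 0 < k by rewrite /k; lra.
  have := zC (fun x => k^-1 * f x) (dual_scale _ _ fd).
  rewrite zZ// ler_pdivrMl// => H; apply: le_trans (H _) _.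
    apply: le_trans (dual_normZ_le _ _ fd) _.
    by rewrite gtr0_norm ?invr_gt0// ler_pdivrMl// mulr1 /k; lra.
  rewrite /k mulrDl mulrC; apply: lerD => //.
  by rewrite mulrAC ler_pdivrMr; [apply: ler_wpM2l; lra|lra].
exists C => f fd; rewrite ler_norml lerNl -mulN1r -zZ// zle// andbT.
apply: le_trans (zle _ (dual_scale _ _ fd)) _; apply: ler_wpM2l => //.
by apply: le_trans (dual_normZ_le _ _ fd) _; rewrite normrN normr1 mul1r.
Qed.

Lemma normr_conv x y (t : R) : 0 < t < 1 ->
  `|t *: x + (1 - t) *: y| <= t * `|x| + (1 - t) * `|y|.
Proof.
move=> /andP[t0 t1]; apply: le_trans (ler_normD _ _) _.
by rewrite !normrZ !ger0_norm//; lra.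
Qed.

(** Separating the single point [x], given the value [- |x|], from the norm yields
    [l x - l s <= |s| - |x|]. Large multiples of a vector in place of [s] give [- l <= |.|], and
    [s = 0] gives [- l x >= |x|]. *)
Lemma norming_functional x : exists2 f, is_dual f & dnorm f <= 1 /\ f x = `|x|.
Proof.
have [||||| l ll lE] := @convex_sandwich R X (fun (u : X) r => u = x /\ r = - `|x|)
    (fun s r => `|s| <= r) 0.
- move=> w r w' r' t _ [-> ->] [-> ->]; split; last by lra.
  by rewrite -scalerDl addrC subrK scale1r.
- move=> u r u' r' t t01 ur ur'; apply: le_trans (normr_conv _ _ _ t01) _.
  by case/andP: t01 => t0 t1; apply: lerD; apply: ler_wpM2l => //; lra.
- by exists x, (- `|x|).
- by move=> v; exists `|v|.
- by move=> w r r' [-> ->]; lra.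
have l0 : l 0 = 0 by have := ll 1 0 0; rewrite scale1r addr0; lra.
have lZ (a : R) v : l (a *: v) = a * l v by have := ll a v 0; rewrite !addr0 l0 addr0.
have lN v : l (- v) = - l v by rewrite -scaleN1r lZ mulN1r.
have H v : - l v <= `|v|.
  apply/ler_addgt0Pr => e e0.
  pose K := `|x| + `|l x|; pose t := (K + 1) / e.
  have K1 : 0 < K + 1 by rewrite /K ltr_wpDl// addr_ge0.
  have t0 : 0 < t by rewrite divr_gt0.
  have := lE x _ (t *: v) _ (conj erefl erefl) (lexx _).
  rewrite lZ normrZ gtr0_norm// addr0 => h.
  have te : t * e = K + 1 by rewrite /t divfK ?gt_eqF.
  have : t * (- l v) <= t * (`|v| + e).
    rewrite mulrN mulrDr te /K; have := ler_norm (- l x); rewrite normrN; have := normr_ge0 x; lra.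
  by rewrite ler_pM2l.
have Hn v : `|- l v| <= 1 * `|v|.
  by rewrite mul1r ler_norml H andbT -[X in - X]normrN -(opprK (l v)) lerN2 -lN H.
have ld : is_dual (fun v => - l v).
  by apply: (@dual_of_bound 1) => // a u v; rewrite ll; lra.
exists (fun v => - l v) => //; split; first exact: dnorm_le.
have := lE x _ 0 _ (conj erefl erefl) (lexx _); rewrite l0 normr0.
by have := H x; lra.
Qed.

End Dual.

(** * Generalized limits of bounded sequences *)

Section GeneralizedLimit.
Context {R : realType}.

Definition bounded_seq (u : nat -> R) : Prop := exists M : R, forall n, `|u n| <= M.

(** Applied pointwise, such an [L] turns a bounded sequence of [X^*] or [X^**] into a limit
    functional that inherits all affine inequalities. This replaces weak* convergent subnets. The
    existence proof takes limits along an ultrafilter refining [\oo]. *)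
Definition generalized_limit (L : (nat -> R) -> R) : Prop :=
  [/\ forall (a : R) u v, bounded_seq u -> bounded_seq v ->
        L (fun n => a * u n + v n) = a * L u + L v,
      forall u v, bounded_seq u -> bounded_seq v ->
        (forall n, u n <= v n) -> L u <= L v &
      forall u (l : R), u @ \oo --> l -> L u = l].

Lemma generalized_limit_exists : exists L, generalized_limit L.
Proof.
have [U [UU ooU]] := ultraFilterLemma (eventually_filter : ProperFilter \oo).
have UP : ProperFilter U by exact: ultra_proper.
have Ucvg u : bounded_seq u -> cvg (u @ U).
  move=> [M uM]; have   := @segment_compact R (- M) M.
  rewrite compact_ultra => /(_ (u @ U)).
  have FU : UltraFilter (u @ U).
    split=> [|G GP sG]; first exact: fmap_proper_filter.
    apply/seteqP; split=> // A GA.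
    have [//|UnA] := in_ultra_setVsetC (u @^-1` A) UU.
    have GC : G (~` A) by exact: sG.
    by have /filter_ex [? []] : G (A `&` ~` A) by exact: filterI.
  move=> /(_ FU); case=> [|p [_ up]]; last by apply/cvg_ex; exists p.
  apply: (@filterS _ U _ setT) => [n _|]; last exact: filterT.
  by rewrite /= in_itv /= -ler_norml.
exists (fun u => lim (u @ U)); split=> [a u v bu bv|u v bu bv uv|u l ul].
- apply: cvg_lim => //; apply: cvgD; last exact: Ucvg.
  by apply: cvgMr; exact: Ucvg.
- by apply: ler_lim; [exact: Ucvg|exact: Ucvg|apply: nearW].
- by apply: cvg_lim => //; apply: cvg_trans ul; apply: cvg_app; exact: ooU.
Qed.

Context {L : (nat -> R) -> R} (LP : generalized_limit L).

Lemma bounded_seqD u v : bounded_seq u -> bounded_seq v -> bounded_seq (fun n => u n + v n).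
Proof.
move=> [M uM] [N vN]; exists (M + N) => n.
by apply: le_trans (ler_normD _ _) _; exact: lerD.
Qed.

Lemma bounded_seqZ (a : R) u : bounded_seq u -> bounded_seq (fun n => a * u n).
Proof.
by move=> [M uM]; exists (`|a| * M) => n; rewrite normrM; exact: ler_wpM2l.
Qed.

Lemma bounded_seq_cst (c : R) : bounded_seq (fun=> c).
Proof. by exists `|c|. Qed.

Lemma bounded_seq_cvg u (l : R) : u @ \oo --> l -> bounded_seq u.
Proof.
move=> ul; have /cvg_seq_bounded [M [_ /(_ (M + 1))]] : cvgn u by apply/cvg_ex; exists l.
by move=> H; exists (M + 1) => n; apply: H => //; lra.
Qed.

Lemma glim_lin (a : R) u v : bounded_seq u -> bounded_seq v ->
  L (fun n => a * u n + v n) = a * L u + L v.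
Proof. by case: LP => + _ _; apply. Qed.

Lemma glim_le u v : bounded_seq u -> bounded_seq v ->
  (forall n, u n <= v n) -> L u <= L v.
Proof. by case: LP => _ + _; apply. Qed.

Lemma glim_cvg u (l : R) : u @ \oo --> l -> L u = l.
Proof. by case: LP => _ _; apply. Qed.

Lemma glim_cst (c : R) : L (fun=> c) = c.
Proof. by apply: glim_cvg; exact: cvg_cst. Qed.

Lemma glimD u v : bounded_seq u -> bounded_seq v -> L (fun n => u n + v n) = L u + L v.
Proof.
move=> bu bv; have := glim_lin 1 _ _ bu bv.
by under eq_fun do rewrite mul1r; rewrite mul1r.
Qed.

Lemma glimZ (a : R) u : bounded_seq u -> L (fun n => a * u n) = a * L u.
Proof.
move=> bu; have := glim_lin a _ _ bu (bounded_seq_cst 0).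
by under eq_fun do rewrite addr0; rewrite glim_cst addr0.
Qed.

Lemma glim_norm_le u (M : R) : (forall n, `|u n| <= M) -> `|L u| <= M.
Proof.
move=> uM; have bu : bounded_seq u by exists M.
have uN n : - M <= u n <= M by rewrite -ler_norml.
rewrite ler_norml; apply/andP; split.
  rewrite -(glim_cst (- M)); apply: glim_le => //; first exact: bounded_seq_cst.
  by move=> n; case/andP: (uN n).
rewrite -[leRHS](glim_cst M); apply: glim_le => //; first exact: bounded_seq_cst.
by move=> n; case/andP: (uN n).
Qed.

End GeneralizedLimit.

(** * Fitzpatrick representatives of the regularizations and of their sum *)

Section Representatives.
Context {R : realType} {X : normedModType R}.
Implicit Types (T : @opX R X) (f g a b : X -> R) (x y w : X) (z : (X -> R) -> R).

(* [fitz_le T z a r] says that the Fitzpatrick function of [T], extended to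
   [X^** * X^*], is at most [r] at [(z, a)]; in the same way [quad_le l z s] says
   [|z|^2 / (2 l) <= s] (for [l = 0]: [z = 0] and [0 <= s]) and [dquad_le l a q]
   says [l |a|^2 / 2 <= q].  Written in this dual form, the conditions are affine. *)
Definition fitz_le T z a (r : R) : Prop :=
  forall w b, T (w, b) -> z b + a w - b w <= r.

Definition quad_le (l : R) z (s : R) : Prop :=
  forall f, is_dual f -> z f <= l / 2 * dnorm f ^+ 2 + s.

Definition dquad_le (l : R) a (q : R) : Prop :=
  forall x, l * a x <= q + l / 2 * `|x| ^+ 2.

Definition yosida_data T (l : R) y a z (r s q : R) : Prop :=
  [/\ is_bidual z, fitz_le T z a r, quad_le l (fun f => f y - z f) s & dquad_le l a q].

Definition yosida_le T (l : R) y a (c : R) : Prop :=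
  exists z r s q, yosida_data T l y a z r s q /\ r + s + q <= c.

(** The infima over the splitting of [g] and over the bidual points are required to be attained, so
    this relation is the closed epigraph only thanks to the compactness argument of [sum_closed]. *)
Definition sum_le T1 T2 (l m : R) y g (c : R) : Prop :=
  exists a1 a2 c1 c2, [/\ is_dual a1 /\ is_dual a2, g = (fun x => a1 x + a2 x),
    yosida_le T1 l y a1 c1, yosida_le T2 m y a2 c2 & c1 + c2 <= c].

(* Type (NI) of Simons. *)
Definition negative_infimum T : Prop :=
  forall z f, is_bidual z -> is_dual f -> forall e : R, 0 < e ->
    exists y g, T (y, g) /\ z (fun x => f x - g x) - (f y - g y) <= e.

(** If the infimum exceeded [e] at [(z, f)], this point would belong to [tilde T]. Along the net
    given by type (D), [z (f - g_i)] and [(f - g_i) (x_i)] are both bounded by a constant times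
    [|f - g_i|], which tends to 0: a contradiction. *)
Lemma typeD_negative_infimum T : typeD T -> negative_infimum T.
Proof.
move=> [[[Tdual _] _] TD] z f zd fd e e0; apply: contrapT => nT.
have Tgt y g : T (y, g) -> e < z (fun x => f x - g x) - (f y - g y).
  by move=> Tyg; rewrite ltNge; apply/negP => le; apply: nT; exists y, g.
have [|I [le [x [g [[_ [_ [_ dir]]] [Tg [[M gM] [_ gf]]]]]]]] := TD z f.
  by split=> //; split=> // y g /Tgt /ltW; apply: le_trans; exact: ltW.
have [_ [C zC]] := zd.
pose K : R := `|C| + `|M| + 1.
have K0 : 0 < K by rewrite ltr_wpDl// addr_ge0.
have [i ile] := gf (e / K) (divr_gt0 e0 K0).
have [k [/ile + _]] := dir i i; rewrite subr0 => dk.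
have gd : is_dual (g k) by exact: (Tdual (x k, g k)).
have fgd := dual_sub f (g k) fd gd.
have := Tgt _ _ (Tg k); apply/negP; rewrite -leNgt.
have dE := dual_normBC f (g k).
have d0 := dual_norm_ge0 _ fgd.
have zb := zC _ fgd; have xb := dnorm_bound _ (x k) fgd.
have [xM _] := gM k.
rewrite ger0_norm -dE// in dk.
set d := dnorm _ in dk d0 zb xb.
have dK : d * K <= e by rewrite -ler_pdivlMr// ltW.
have zb' : z (fun x0 : X => f x0 - g k x0) <= d * `|C|.
  apply: le_trans (ler_norm _) _; apply: le_trans zb _; rewrite mulrC.
  by apply: ler_wpM2l => //; exact: ler_norm.
have xb' : - (f (x k) - g k (x k)) <= d * `|M|.
  apply: le_trans (ler_norm _) _; rewrite normrN; apply: le_trans xb _.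
  by apply: ler_wpM2l => //; apply: le_trans xM _; exact: ler_norm.
by move: dK; rewrite /K !mulrDr mulr1; lra.
Qed.

Lemma negative_infimum_nonempty T : negative_infimum T -> exists w b, T (w, b).
Proof.
move=> /(_ _ _ (embed_bidual 0) is_dual0 1 ltr01) [y [g [Tyg _]]].
by exists y, g.
Qed.

Lemma fitz_ge T z a (r : R) : dual_op T -> negative_infimum T -> is_bidual z ->
  is_dual a -> fitz_le T z a r -> z a <= r.
Proof.
move=> Td TN zd ad zr; apply/ler_addgt0Pr => e e0.
have [y [g [Tyg]]] := TN z a zd ad e e0.
rewrite bidualB//; last exact: (Td _ Tyg).
by have := zr _ _ Tyg; lra.
Qed.

Lemma dquad_leP (l : R) a (q : R) : 0 <= l -> is_dual a ->
  dquad_le l a q <-> l / 2 * dnorm a ^+ 2 <= q.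
Proof.
move=> l0 ad; have n0 := dual_norm_ge0 a ad; split=> [aq|aq x].
  apply/ler_addgt0Pr => e e0.
  have K0 : 0 < l * dnorm a + 1 by rewrite ltr_wpDl// mulr_ge0.
  have [v v1 av] := dnorm_adherent a _ ad (divr_gt0 e0 K0).
  have := aq (dnorm a *: v); rewrite dualZ// normrZ ger0_norm//.
  have v2 : (dnorm a * `|v|) ^+ 2 <= dnorm a ^+ 2.
    rewrite exprMn -[leRHS]mulr1; apply: ler_wpM2l; first exact: sqr_ge0.
    by rewrite expr_le1.
  have : l * (dnorm a * (dnorm a - e / (l * dnorm a + 1))) <= l * (dnorm a * a v).
    by do 2 apply: ler_wpM2l => //; exact: ltW.
  have : l / 2 * (dnorm a * `|v|) ^+ 2 <= l / 2 * dnorm a ^+ 2.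
    by apply: ler_wpM2l => //; lra.
  have : l * dnorm a * (e / (l * dnorm a + 1)) <= e.
    rewrite mulrCA -[leRHS]mulr1; apply: ler_wpM2l; first exact: ltW.
    by rewrite ler_pdivrMr// mul1r; lra.
  set k := e / _; rewrite !mulrBr !expr2 !mulrA; lra.
have ax := dnorm_bound_le a x ad.
have : l * a x <= l * (dnorm a * `|x|) by exact: ler_wpM2l.
have : 0 <= l / 2 * (dnorm a - `|x|) ^+ 2.
  by apply: mulr_ge0; [lra|exact: sqr_ge0].
by move: aq; rewrite !expr2 !(mulrBr, mulrBl); lra.
Qed.

Lemma quad_ge0 (l : R) z (s : R) : z (fun=> 0) = 0 -> quad_le l z s -> 0 <= s.
Proof.
move=> z0 /(_ _ is_dual0); rewrite z0.
have -> : dnorm (fun _ : X => 0 : R) = 0.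
  apply/eqP; rewrite eq_le dual_norm_ge0 ?andbT; last exact: is_dual0.
  by apply: dnorm_le => // x; rewrite normr0 mul0r.
by rewrite expr2 !mulr0; lra.
Qed.

Lemma dquad_ge0 (l : R) a (q : R) : is_dual a -> dquad_le l a q -> 0 <= q.
Proof.
by move=> ad /(_ 0); rewrite dual0// normr0 expr2 !mulr0; lra.
Qed.

(** Write [a y = (a y - z a) + z a]. The last term is at most [r], and [quad_le] tested at [a]
    bounds the first by [s + l |a|^2 / 2]; the dual quadratic [q] pays for the excess. *)
Lemma yosida_ge T (l : R) y a (c : R) : 0 <= l -> dual_op T -> negative_infimum T ->
  is_dual a -> yosida_le T l y a c -> a y <= c.
Proof.
move=> l0 Td TN ad [z [r [s [q [[zd zr zs /dquad_leP aq] le]]]]].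
have := fitz_ge _ _ _ _ Td TN zd ad zr; have := zs _ ad; have := aq l0 ad; lra.
Qed.

Lemma sum_ge T1 T2 (l m : R) y g (c : R) : 0 <= l -> 0 <= m ->
  dual_op T1 -> negative_infimum T1 -> dual_op T2 -> negative_infimum T2 ->
  sum_le T1 T2 l m y g c -> g y <= c.
Proof.
move=> l0 m0 Td1 TN1 Td2 TN2 [a1 [a2 [c1 [c2 [[a1d a2d] -> y1 y2 le]]]]].
by have := yosida_ge _ _ _ _ _ l0 Td1 TN1 a1d y1;
  have := yosida_ge _ _ _ _ _ m0 Td2 TN2 a2d y2; lra.
Qed.

Lemma convex_combine_le (t A B C D : R) : 0 < t < 1 -> A <= B -> C <= D ->
  t * A + (1 - t) * C <= t * B + (1 - t) * D.
Proof.
by move=> /andP[t0 t1] AB CD; apply: lerD; apply: ler_wpM2l => //; lra.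
Qed.

Lemma dnorm_sqr_conv (t : R) f g : 0 < t < 1 -> is_dual f -> is_dual g ->
  dnorm (fun x => t * f x + (1 - t) * g x) ^+ 2 <= t * dnorm f ^+ 2 + (1 - t) * dnorm g ^+ 2.
Proof.
move=> /andP[t0 t1] fd gd; have := dnorm_lincomb t (1 - t) f g fd gd.
have t1' : 0 < 1 - t by lra.
rewrite !gtr0_norm// => H.
have := dual_norm_ge0 _ (dual_lincomb t (1 - t) f g fd gd) => H0.
apply: (@le_trans _ _ ((t * dnorm f + (1 - t) * dnorm g) ^+ 2)).
  by rewrite lerXn2r// nnegrE; lra.
have : 0 <= t * (1 - t) * (dnorm f - dnorm g) ^+ 2.
  by rewrite mulr_ge0 ?sqr_ge0// mulr_ge0//; lra.
by rewrite !expr2 !(mulrDl, mulrDr, mulrBl, mulrBr); lra.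
Qed.

Lemma yosida_convex T (l : R) y a (c : R) y' a' (c' : R) (t : R) : 0 <= l ->
  0 < t < 1 -> yosida_le T l y a c -> yosida_le T l y' a' c' ->
  yosida_le T l (t *: y + (1 - t) *: y') (fun x => t * a x + (1 - t) * a' x)
    (t * c + (1 - t) * c').
Proof.
move=> l0 t01 [z [r [s [q [[zd zr zs aq] le]]]]] [z' [r' [s' [q' [[zd' zr' zs' aq'] le']]]]].
exists (fun f => t * z f + (1 - t) * z' f), (t * r + (1 - t) * r'),
  (t * s + (1 - t) * s'), (t * q + (1 - t) * q').
split; [split|].
- exact: bidual_lincomb.
- move=> w b Tw; have := convex_combine_le _ _ _ _ _ t01 (zr _ _ Tw) (zr' _ _ Tw).
  by rewrite !(mulrDr, mulrBr, mulrDl, mulrBl); lra.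
- move=> f fd; have := convex_combine_le _ _ _ _ _ t01 (zs _ fd) (zs' _ fd).
  by rewrite (dualD f)// !(dualZ f)// !(mulrDr, mulrBr); lra.
- move=> x; have := convex_combine_le _ _ _ _ _ t01 (aq x) (aq' x).
  by rewrite !(mulrDr, mulrBr, mulrDl, mulrBl); lra.
- by have := convex_combine_le _ _ _ _ _ t01 le le'; lra.
Qed.

Lemma sum_convex T1 T2 (l m : R) y g (c : R) y' g' (c' : R) (t : R) :
  0 <= l -> 0 <= m -> 0 < t < 1 ->
  sum_le T1 T2 l m y g c -> sum_le T1 T2 l m y' g' c' ->
  sum_le T1 T2 l m (t *: y + (1 - t) *: y') (fun x => t * g x + (1 - t) * g' x)
    (t * c + (1 - t) * c').
Proof.
move=> l0 m0 t01 [a1 [a2 [c1 [c2 [[a1d a2d] -> y1 y2 le]]]]].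
move=> [b1 [b2 [d1 [d2 [[b1d b2d] -> z1 z2 le']]]]].
exists (fun x => t * a1 x + (1 - t) * b1 x), (fun x => t * a2 x + (1 - t) * b2 x),
  (t * c1 + (1 - t) * d1), (t * c2 + (1 - t) * d2); split.
- by split; exact: dual_lincomb.
- by apply/funext => x; ring.
- exact: yosida_convex.
- exact: yosida_convex.
- by have := convex_combine_le _ _ _ _ _ t01 le le'; lra.
Qed.

Lemma sum_le_sym T1 T2 (l m : R) y g (c : R) :
  sum_le T1 T2 l m y g c -> sum_le T2 T1 m l y g c.
Proof.
move=> [a1 [a2 [c1 [c2 [[a1d a2d] -> y1 y2 le]]]]].
exists a2, a1, c2, c1; split=> //; last by rewrite addrC.
by apply/funext => x; rewrite addrC.
Qed.

End Representatives.

(** * Bounds on certificates and closedness of the sum representative *)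

Section Closedness.
Context {R : realType} {X : normedModType R}.
Implicit Types (T : @opX R X) (f g a b : X -> R) (x y w : X) (z : (X -> R) -> R).

Lemma yosida_data_ge T (l : R) y a z (r s q : R) w b :
  0 <= l -> T (w, b) -> is_dual b -> yosida_data T l y a z r s q ->
  b y - l * dnorm b ^+ 2 - s / 2 + a w - b w <= r.
Proof.
move=> l0 Tw bd [zd zr zs _]; have := zr _ _ Tw.
(* Testing at [2 b] rather than [b] charges only [s / 2], so that [r + s] still controls [s]. *)
have := zs _ (dual_scale 2 b bd); rewrite bidualZ//.
have n0 := dual_norm_ge0 _ bd.
have : dnorm (fun x => 2 * b x) ^+ 2 <= (2 * dnorm b) ^+ 2.
  rewrite lerXn2r ?nnegrE ?dual_norm_ge0 ?mulr_ge0//; first exact: dual_scale.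
  by have := dual_normZ_le 2 b bd; rewrite ger0_norm.
move=> /(ler_wpM2l l0); rewrite exprMn; lra.
Qed.

(** One graph point gives [r >= - K - s / 2]; with [s] and [q] nonnegative, a bound on [r + s + q]
    therefore bounds each of the three, and the bound on [s] keeps [z] at a bounded distance from
    [y]. *)
Lemma yosida_data_bounded T (l M : R) w b : 0 <= l -> T (w, b) -> is_dual b ->
  exists B : R, forall y a z (r s q : R), is_dual a -> yosida_data T l y a z r s q ->
    `|y| <= M -> dnorm a <= M -> r + s + q <= M ->
    [/\ `|r| <= B, `|s| <= B, `|q| <= B &
        forall f, is_dual f -> `|z f| <= B * dnorm f].
Proof.
move=> l0 Tw bd.
pose K := dnorm b * (M + `|w|) + l * dnorm b ^+ 2 + M * `|w|.
exists (4 * M + 4 * K + l) => y a z r s q ad dat yM aM cM.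
have M0 : 0 <= M by apply: le_trans yM.
have n0 := dual_norm_ge0 _ bd.
have K0 : 0 <= K.
  by rewrite /K !addr_ge0// ?mulr_ge0 ?addr_ge0 ?sqr_ge0.
have rge : - K - s / 2 <= r.
  apply: le_trans (yosida_data_ge _ _ _ _ _ _ _ _ _ _ l0 Tw bd dat).
  have := dnorm_bound b y bd; have := dnorm_bound b w bd; have := dnorm_bound a w ad.
  have : dnorm b * `|y| <= dnorm b * M by exact: ler_wpM2l.
  have : dnorm a * `|w| <= M * `|w| by exact: ler_wpM2r.
  by rewrite /K !ler_norml mulrDr; lra.
case: dat => zd _ zs aq.
have s0 : 0 <= s by apply: quad_ge0 zs; rewrite bidual0// subr0.
have q0 : 0 <= q by exact: dquad_ge0 aq.
split; [by rewrite ler_norml; lra|by rewrite ger0_norm; lra|by rewrite ger0_norm; lra|].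
have zle f : is_dual f -> dnorm f <= 1 -> - z f <= M + l / 2 + s.
  move=> fd f1; have := zs f fd; have := dnorm_bound f y fd.
  have f0 := dual_norm_ge0 f fd.
  have : dnorm f * `|y| <= 1 * M by exact: ler_pM.
  have : l / 2 * dnorm f ^+ 2 <= l / 2 * 1.
    by apply: ler_wpM2l; [lra|rewrite expr_le1].
  by rewrite ler_norml; lra.
move=> f fd; have [f0|f0] := eqVneq (dnorm f) 0.
  by have [_ [C /(_ f fd)]] := zd; rewrite f0 !mulr0.
have nf : 0 < dnorm f by rewrite lt_def f0 dual_norm_ge0.
have unit (e : R) : `|e| = 1 -> dnorm (fun x => e / dnorm f * f x) <= 1.
  move=> e1; apply: le_trans (dual_normZ_le _ _ fd) _.
  by rewrite normrM e1 mul1r gtr0_norm ?invr_gt0// mulVf.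
rewrite -ler_pdivrMr// -{1}(gtr0_norm nf) -normf_div ler_norml mulrC.
have := zle _ (dual_scale (1 / dnorm f) f fd) (unit 1 (normr1 _)).
have := zle _ (dual_scale (-1 / dnorm f) f fd) (unit (-1) ltac:(by rewrite normrN normr1)).
by rewrite !bidualZ// mulN1r mul1r; lra.
Qed.

(** Only [a1 + a2] is controlled by assumption. Adding the lower bounds for [c1] and [c2] and
    eliminating [a2] leaves [q1 + a1 (w1 - w2) <= P]; since [l > 0], the quadratic [q1] dominates
    the linear term and then bounds [a1]. *)
Lemma sum_bounded T1 T2 (l m M : R) w1 b1 w2 b2 : 0 < l -> 0 <= m ->
  T1 (w1, b1) -> is_dual b1 -> T2 (w2, b2) -> is_dual b2 ->
  exists B : R, forall y a1 a2 (c1 c2 : R), is_dual a1 -> is_dual a2 ->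
    yosida_le T1 l y a1 c1 -> yosida_le T2 m y a2 c2 -> c1 + c2 <= M ->
    `|y| <= M -> dnorm (fun x => a1 x + a2 x) <= M ->
    [/\ dnorm a1 <= B, dnorm a2 <= B, `|c1| <= B & `|c2| <= B].
Proof.
move=> l0 m0 Tw1 bd1 Tw2 bd2.
pose k (l : R) w b := dnorm b * (M + `|w|) + l * dnorm b ^+ 2.
have kP T (l' : R) w b y a (c : R) : 0 <= l' -> T (w, b) -> is_dual b -> is_dual a ->
    `|y| <= M -> yosida_le T l' y a c ->
    0 <= k l' w b /\
    exists2 q, dquad_le l' a q & 0 <= q /\ q + a w - k l' w b <= c.
  move=> l'0 Tw bd ad yM [z [r [s [q [dat le]]]]].
  have M0 : 0 <= M by apply: le_trans yM.
  split; first by rewrite /k addr_ge0 ?mulr_ge0 ?addr_ge0 ?sqr_ge0 ?dual_norm_ge0.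
  have := yosida_data_ge _ _ _ _ _ _ _ _ _ _ l'0 Tw bd dat.
  case: dat => zd _ zs aq.
  have s0 : 0 <= s by apply: quad_ge0 zs; rewrite bidual0// subr0.
  have q0 : 0 <= q by exact: dquad_ge0 aq.
  exists q => //; split=> //.
  have := dnorm_bound b y bd; have := dnorm_bound b w bd.
  have : dnorm b * `|y| <= dnorm b * M by apply: ler_wpM2l => //; exact: dual_norm_ge0.
  by rewrite /k !ler_norml mulrDr; lra.
pose k1 := k l w1 b1; pose k2 := k m w2 b2.
pose v := w1 - w2; pose P := M + k1 + k2 + M * `|w2|.
pose Q := 2 * (P + `|v| ^+ 2 / l); pose A := 1 + 2 * Q / l.
exists (2 * M + A + (M + A) * `|w2| + A * `|w1| + k1 + k2) => y a1 a2 c1 c2 ad1 ad2 Y1 Y2 cM yM gM.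
have [k10 [q1 aq1 [q10 c1q]]] := kP _ _ _ _ _ _ _ (ltW l0) Tw1 bd1 ad1 yM Y1.
have [k20 [q2 aq2 [q20 c2q]]] := kP _ _ _ _ _ _ _ m0 Tw2 bd2 ad2 yM Y2.
rewrite -/k1 in k10 c1q; rewrite -/k2 in k20 c2q.
have M0 : 0 <= M by apply: le_trans yM.
have gd := dual_add _ _ ad1 ad2.
have gw : `|a1 w2 + a2 w2| <= M * `|w2|.
  by apply: le_trans (dnorm_bound _ w2 gd) _; exact: ler_wpM2r.
have P1 : q1 + a1 v <= P.
  by move: gw; rewrite /v (dualB a1)// ler_norml /P; lra.
have P2 : - a1 v <= q1 / 2 + `|v| ^+ 2 / l.
  (* The multiple [- 2 / l] is chosen so that only half of [q1] is spent on [- a1 v]. *)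
  have := aq1 ((- (2 / l)) *: v); rewrite (dualZ a1)// normrZ normrN gtr0_norm ?divr_gt0//.
  have -> : l * (- (2 / l) * a1 v) = - 2 * a1 v by field; rewrite gt_eqF.
  have -> : l / 2 * (2 / l * `|v|) ^+ 2 = 2 * (`|v| ^+ 2 / l) by field; rewrite gt_eqF.
  by lra.
have q1Q : q1 <= Q by rewrite /Q; lra.
have n10 := dual_norm_ge0 _ ad1.
have n1A : dnorm a1 <= A.
  have := iffLR (dquad_leP l a1 q1 (ltW l0) ad1) aq1 => n1q.
  have : dnorm a1 ^+ 2 <= 2 * Q / l.
    by rewrite ler_pdivlMr//; move: n1q; rewrite mulrC; lra.
  have : 0 <= (dnorm a1 - 1) ^+ 2 by exact: sqr_ge0.
  by rewrite /A !expr2 !(mulrBr, mulrBl); lra.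
have n2A : dnorm a2 <= M + A.
  have : dnorm a2 <= dnorm (fun x => a1 x + a2 x) + dnorm a1.
    have := dual_normB _ _ gd ad1.
    by under eq_fun do rewrite addrAC subrr add0r.
  by lra.
have a1w : `|a1 w1| <= A * `|w1|.
  by apply: le_trans (dnorm_bound _ _ ad1) _; exact: ler_wpM2r.
have a2w : `|a2 w2| <= (M + A) * `|w2|.
  by apply: le_trans (dnorm_bound _ _ ad2) _; exact: ler_wpM2r.
have A0 : 0 <= A by lra.
have Aw : 0 <= A * `|w1| by exact: mulr_ge0.
have MAw : 0 <= (M + A) * `|w2| by apply: mulr_ge0 => //; lra.
move: a1w a2w; rewrite !ler_norml => /andP[? ?] /andP[? ?].
by split; [lra|lra|apply/andP; split; lra|apply/andP; split; lra].
Qed.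

(** For a fixed test element each defining condition is an affine inequality in [(z, a, r, s, q)],
    hence stable under [L]. The base point enters only through [f (Y n)], which converges because
    [Y] converges in norm. *)
Lemma yosida_limit (L : (nat -> R) -> R) T (l M : R) (Y : nat -> X) y
    (a : nat -> X -> R) (c : nat -> R) :
  generalized_limit L -> 0 <= l -> dual_op T -> (exists w b, T (w, b)) ->
  Y @ \oo --> y -> (forall n, `|Y n| <= M) ->
  (forall n, is_dual (a n) /\ dnorm (a n) <= M) -> (forall n, `|c n| <= M) ->
  (forall n, yosida_le T l (Y n) (a n) (c n)) ->
  is_dual (fun x => L (fun n => a n x)) /\
  yosida_le T l y (fun x => L (fun n => a n x)) (L c).
Proof.
move=> LP l0 Td [w0 [b0 Tw0]] Yy YM aM cM Yos.
have bd0 : is_dual b0 := Td _ Tw0.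
have bc : bounded_seq c by exists M.
have ba x : bounded_seq (fun n => a n x).
  exists (M * `|x|) => n; have [ad an] := aM n.
  by apply: le_trans (dnorm_bound _ _ ad) _; exact: ler_wpM2r.
split.
  apply: (@dual_of_bound _ _ M) => [k u v|x].
    have -> : (fun n => a n (k *: u + v)) = (fun n => k * a n u + a n v).
      by apply/funext => n; have [[al _] _] := aM n; exact: al.
    exact: glim_lin.
  apply: glim_norm_le => // n; have [ad an] := aM n.
  by apply: le_trans (dnorm_bound _ _ ad) _; exact: ler_wpM2r.
have [B BP] := yosida_data_bounded T l M w0 b0 l0 Tw0 bd0.
have /choice[F FP] n : exists p : ((X -> R) -> R) * (R * R * R),
    yosida_data T l (Y n) (a n) p.1 p.2.1.1 p.2.1.2 p.2.2 /\
    p.2.1.1 + p.2.1.2 + p.2.2 <= c n.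
  by have [z [r [s [q H]]]] := Yos n; exists (z, (r, s, q)).
pose z n := (F n).1; pose r n := (F n).2.1.1; pose s n := (F n).2.1.2; pose q n := (F n).2.2.
have dat n : yosida_data T l (Y n) (a n) (z n) (r n) (s n) (q n) by have [] := FP n.
have cle n : r n + s n + q n <= c n by have [] := FP n.
have bnd n : [/\ `|r n| <= B, `|s n| <= B, `|q n| <= B &
    forall f, is_dual f -> `|z n f| <= B * dnorm f].
  have [ad an] := aM n; apply: BP (dat n) _ _ _ => //.
  by apply: le_trans (cle n) _; apply: le_trans (cM n); exact: ler_norm.
have br : bounded_seq r by exists B => n; have [] := bnd n.
have bs : bounded_seq s by exists B => n; have [] := bnd n.
have bq : bounded_seq q by exists B => n; have [] := bnd n.
have bz f : is_dual f -> bounded_seq (fun n => z n f).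
  by move=> fd; exists (B * dnorm f) => n; have [_ _ _ /(_ f fd)] := bnd n.
have cst := @bounded_seq_cst R.
exists (fun f => L (fun n => z n f)), (L r), (L s), (L q); split; last first.
  rewrite -(glimD LP _ _ br bs) -(glimD LP _ _ (bounded_seqD _ _ br bs) bq).
  by apply: (glim_le LP) => //; do 2 apply: bounded_seqD => //.
split.
- split=> [k f g fd gd|].
    have -> : (fun n => z n (fun x => k * f x + g x)) = (fun n => k * z n f + z n g).
      by apply/funext => n; have [[zl _] _ _ _] := dat n; exact: zl.
    by apply: (glim_lin LP); exact: bz.
  by exists B => f fd; apply: (glim_norm_le LP) => n; have [_ _ _ /(_ f fd)] := bnd n.
- move=> w b Tw; have bzb := bz b (Td _ Tw).
  have bau : bounded_seq (fun n => a n w + - b w) by exact: bounded_seqD.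
  have E : L (fun n => z n b + (a n w + - b w)) = L (fun n => z n b) + L (fun n => a n w) - b w.
    by rewrite (glimD LP)// (glimD LP)// (glim_cst LP) addrA.
  rewrite -E; apply: (glim_le LP) => //; first exact: bounded_seqD.
  by move=> n; have [_ /(_ _ _ Tw) + _ _] := dat n; lra.
- move=> f fd; have fY : (fun n => f (Y n)) @ \oo --> f y.
    by apply: continuous_cvg => //; exact: fd.2.
  have bfY := bounded_seq_cvg _ _ fY; have bzf := bz f fd.
  have bNz : bounded_seq (fun n => -1 * z n f) by exact: bounded_seqZ.
  have E : L (fun n => f (Y n) + -1 * z n f) = f y - L (fun n => z n f).
    by rewrite (glimD LP)// (glimZ LP)// (glim_cvg LP _ _ fY) mulN1r.
  have E' : L (fun n => l / 2 * dnorm f ^+ 2 + s n) = l / 2 * dnorm f ^+ 2 + L s.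
    by rewrite (glimD LP)// (glim_cst LP).
  rewrite -E -E'; apply: (glim_le LP) => //; [exact: bounded_seqD|exact: bounded_seqD|].
  by move=> n; have [_ _ /(_ f fd) + _] := dat n; lra.
- move=> x; have E : L (fun n => q n + l / 2 * `|x| ^+ 2) = L q + l / 2 * `|x| ^+ 2.
    by rewrite (glimD LP)// (glim_cst LP).
  rewrite -(glimZ LP)// -E.
  apply: (glim_le LP) => //; [exact: bounded_seqZ|exact: bounded_seqD|].
  by move=> n; have [_ _ _ /(_ x)] := dat n.
Qed.

Lemma sum_closed_pos T1 T2 (l m : R) y g (c : R) : 0 < l -> 0 <= m ->
  dual_op T1 -> (exists w b, T1 (w, b)) -> dual_op T2 -> (exists w b, T2 (w, b)) ->
  is_dual g ->
  (forall e : R, 0 < e -> exists y' g' (c' : R), [/\ sum_le T1 T2 l m y' g' c',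
     `|y' - y| < e, dnorm (fun x => g' x - g x) < e & c' < c + e]) ->
  sum_le T1 T2 l m y g c.
Proof.
move=> l0 m0 Td1 ne1 Td2 ne2 gd H.
have [L LP] := @generalized_limit_exists R.
have [w1 [b1 Tw1]] := ne1; have [w2 [b2 Tw2]] := ne2.
pose M : R := `|y| + dnorm g + `|c| + 1.
have [B BP] := sum_bounded T1 T2 l m M w1 b1 w2 b2 l0 m0 Tw1 (Td1 _ Tw1) Tw2 (Td2 _ Tw2).
have /choice[F FP] n : exists p : X * ((X -> R) * (X -> R)) * (R * R),
    [/\ is_dual p.1.2.1 /\ is_dual p.1.2.2,
     yosida_le T1 l p.1.1 p.1.2.1 p.2.1, yosida_le T2 m p.1.1 p.1.2.2 p.2.2 &
     [/\ `|p.1.1 - y| < n.+1%:R^-1,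
     dnorm (fun x => (p.1.2.1 x + p.1.2.2 x) - g x) < n.+1%:R^-1 &
     p.2.1 + p.2.2 < c + n.+1%:R^-1]].
  have [|y' [g' [c' [[a1 [a2 [c1 [c2 [ad g'E Y1 Y2 cc]]]]] yy gg c'c]]]] := H n.+1%:R^-1.
    by rewrite invr_gt0.
  exists ((y', (a1, a2)), (c1, c2)); split=> //=; split=> //; first by rewrite g'E in gg.
  exact: le_lt_trans cc c'c.
pose Y n := (F n).1.1; pose a1 n := (F n).1.2.1; pose a2 n := (F n).1.2.2.
pose c1 n := (F n).2.1; pose c2 n := (F n).2.2.
have ad1 n : is_dual (a1 n) by have [[]] := FP n.
have ad2 n : is_dual (a2 n) by have [[]] := FP n.
have Yos1 n : yosida_le T1 l (Y n) (a1 n) (c1 n) by have [] := FP n.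
have Yos2 n : yosida_le T2 m (Y n) (a2 n) (c2 n) by have [] := FP n.
have dY n : `|Y n - y| < n.+1%:R^-1 by have [_ _ _ []] := FP n.
have dg n : dnorm (fun x => (a1 n x + a2 n x) - g x) < n.+1%:R^-1 by have [_ _ _ []] := FP n.
have dc n : c1 n + c2 n < c + n.+1%:R^-1 by have [_ _ _ []] := FP n.
have inv1 n : n.+1%:R^-1 <= 1 :> R by rewrite invf_le1// ler1n.
have gn0 := dual_norm_ge0 g gd.
have YM n : `|Y n| <= M.
  have := ler_normD (Y n - y) y; rewrite subrK => h.
  have := lt_le_trans (dY n) (inv1 n); have := normr_ge0 c; rewrite /M; lra.
have Bn n : [/\ dnorm (a1 n) <= B, dnorm (a2 n) <= B, `|c1 n| <= B & `|c2 n| <= B].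
  apply: (BP (Y n)) => //.
    have := lt_le_trans (dc n) (lerD (lexx c) (inv1 n)); have := normr_ge0 y; have := ler_norm c; rewrite /M; lra.
  have sd := dual_add _ _ (ad1 n) (ad2 n).
  have := dual_normD _ _ (dual_sub _ _ sd gd) gd.
  under eq_fun do rewrite subrK; move=> h.
  have := lt_le_trans (dg n) (inv1 n); have := normr_ge0 y; have := normr_ge0 c; rewrite /M; lra.
have inv0 : (fun n => n.+1%:R^-1 : R) @ \oo --> (0 : R) by exact: cvg_harmonic.
have Yy : Y @ \oo --> y.
  apply/cvgrPdist_lt => e e0; have /cvgrPdist_lt /(_ e e0) := inv0.
  apply: filterS => n; rewrite sub0r normrN ger0_norm// distrC; exact: lt_trans.
pose N := M + B.
have B0 : 0 <= B by have [h _ _ _] := Bn 0%N; apply: le_trans h; exact: dual_norm_ge0.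
have M0 : 0 <= M by apply: le_trans (YM 0%N).
have [Ld1 Lim1] : is_dual (fun x => L (fun n => a1 n x)) /\
    yosida_le T1 l y (fun x => L (fun n => a1 n x)) (L c1).
  apply: (@yosida_limit L T1 l N Y) => //; first exact: ltW.
  - by move=> n; apply: le_trans (YM n) _; rewrite /N; lra.
  - by move=> n; split=> //; have [h _ _ _] := Bn n; apply: le_trans h _; rewrite /N; lra.
  - by move=> n; have [_ _ h _] := Bn n; apply: le_trans h _; rewrite /N; lra.
have [Ld2 Lim2] : is_dual (fun x => L (fun n => a2 n x)) /\
    yosida_le T2 m y (fun x => L (fun n => a2 n x)) (L c2).
  apply: (@yosida_limit L T2 m N Y) => //.
  - by move=> n; apply: le_trans (YM n) _; rewrite /N; lra.
  - by move=> n; split=> //; have [_ h _ _] := Bn n; apply: le_trans h _; rewrite /N; lra.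
  - by move=> n; have [_ _ _ h] := Bn n; apply: le_trans h _; rewrite /N; lra.
have bc1 : bounded_seq c1 by exists B => n; have [] := Bn n.
have bc2 : bounded_seq c2 by exists B => n; have [] := Bn n.
exists (fun x => L (fun n => a1 n x)), (fun x => L (fun n => a2 n x)), (L c1), (L c2).
split=> //.
  apply/funext => x.
  have ba (a : nat -> X -> R) : (forall n, is_dual (a n) /\ dnorm (a n) <= B) ->
      bounded_seq (fun n => a n x).
    move=> aB; exists (B * `|x|) => n; have [ad an] := aB n.
    by apply: le_trans (dnorm_bound _ _ ad) _; exact: ler_wpM2r.
  rewrite -(glimD LP); last 2 first.
  - by apply: ba => n; split=> //; have [] := Bn n.
  - by apply: ba => n; split=> //; have [] := Bn n.
  (* The summands have only generalized limits, but their sum at [x] truly converges to [g x], so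
     the limits still split [g]. *)
  apply/esym/(glim_cvg LP).
  have xinv : (fun n => `|x| * n.+1%:R^-1 : R) @ \oo --> (0 : R).
    by rewrite -(mulr0 `|x|); apply: cvgMr.
  apply/cvgrPdist_lt => e e0; have /cvgrPdist_lt /(_ e e0) := xinv.
  apply: filterS => n; rewrite sub0r normrN ger0_norm ?mulr_ge0// distrC.
  apply: le_lt_trans; have sd := dual_sub _ _ (dual_add _ _ (ad1 n) (ad2 n)) gd.
  apply: le_trans (dnorm_bound _ x sd) _; rewrite mulrC; apply: ler_wpM2l => //.
  exact: ltW.
rewrite -(glimD LP) //.
have cinv : (fun n => c + n.+1%:R^-1 : R) @ \oo --> c.
  by rewrite -[X in _ --> X]addr0; apply: cvgD => //; exact: cvg_cst.
rewrite -(glim_cvg LP _ _ cinv); apply: (glim_le LP).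
- exact: bounded_seqD.
- exact: bounded_seq_cvg cinv.
- by move=> n; exact: ltW.
Qed.

Lemma sum_closed T1 T2 (l m : R) y g (c : R) : 0 <= l -> 0 <= m -> 0 < l + m ->
  dual_op T1 -> (exists w b, T1 (w, b)) -> dual_op T2 -> (exists w b, T2 (w, b)) ->
  is_dual g ->
  (forall e : R, 0 < e -> exists y' g' (c' : R), [/\ sum_le T1 T2 l m y' g' c',
     `|y' - y| < e, dnorm (fun x => g' x - g x) < e & c' < c + e]) ->
  sum_le T1 T2 l m y g c.
Proof.
move=> l0 m0 lm Td1 ne1 Td2 ne2 gd H.
have [l1|l1] := ltP 0 l; first exact: sum_closed_pos.
apply: sum_le_sym; apply: sum_closed_pos => // [|e e0]; first lra.
have [y' [g' [c' [S1 S2 S3 S4]]]] := H e e0.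
by exists y', g', c'; split=> //; exact: sum_le_sym.
Qed.

End Closedness.

(** * The dual as a vector space *)

Section DualSpace.
Context {R : realType} {X : normedModType R}.

(** Hahn-Banach will be applied on a product involving [X^*], which must therefore be a module type;
    [R^o] supplies the module structure on functions. *)
Definition dual_pred : {pred (X -> R^o)} := fun f => `[< @is_dual R X f >].

Lemma dual_pred_submod_closed : submod_closed dual_pred.
Proof.
split=> [|c f g]; first by apply/asboolP; exact: is_dual0.
move=> /asboolP fd /asboolP gd; apply/asboolP.
by have := dual_lincomb c 1 f g fd gd; under eq_fun do rewrite mul1r.
Qed.

HB.instance Definition _ :=
  GRing.isSubmodClosed.Build R (X -> R^o) dual_pred dual_pred_submod_closed.

Record dual_space := DualSpace { dual_fun :> X -> R^o; _ : dual_fun \in dual_pred }.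

HB.instance Definition _ := [isSub for dual_fun].
HB.instance Definition _ := [Choice of dual_space by <:].
HB.instance Definition _ := [SubChoice_isSubLmodule of dual_space by <:].

Lemma dual_spaceP (a : dual_space) : @is_dual R X a.
Proof. by case: a => f /= /asboolP. Qed.

Definition to_dual_space (f : X -> R) (fd : is_dual f) : dual_space :=
  @DualSpace f (asboolT fd).

Lemma extend_bidual (U : dual_space -> R) (C : R) :
  (forall (t : R) a b, U (t *: a + b) = t * U a + U b) ->
  (forall a : dual_space, dnorm (a : X -> R) <= 1 -> U a <= C) ->
  exists2 z, is_bidual z & forall a : dual_space, z a = U a.
Proof.
move=> Ul UC.
(* The value 0 off the dual is a mere default: [is_bidual] constrains [z] on [X^*] only. *)
pose z (f : X -> R) :=
  if pselect (is_dual f) is left fd then U (to_dual_space f fd) else 0.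
have zE (a : dual_space) : z a = U a.
  rewrite /z; case: pselect => [fd|]; last by case; exact: dual_spaceP.
  by congr U; exact: val_inj.
have zE' f (fd : is_dual f) : z f = U (to_dual_space f fd) by rewrite -zE.
exists z => //; apply: (@bidual_of_unit_bound _ _ C) => [c f g fd gd|f fd f1].
  by rewrite (zE' _ fd) (zE' _ gd) -Ul -zE.
by rewrite (zE' _ fd); exact: UC.
Qed.

Lemma dual_of_unit_bound (C : R) (u : X -> R) :
  (forall (t : R) x y, u (t *: x + y) = t * u x + u y) ->
  (forall x, `|x| <= 1 -> u x <= C) -> is_dual u.
Proof.
move=> ul uC; apply: (@dual_of_bound _ _ C) => // x.
have u0 : u 0 = 0 by have := ul 1 0 0; rewrite scale1r addr0; lra.
have uZ (t : R) v : u (t *: v) = t * u v by have := ul t v 0; rewrite !addr0 u0 addr0.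
have [->|x0] := eqVneq x 0; first by rewrite u0 !normr0 mulr0.
have nx : 0 < `|x| by rewrite normr_gt0.
have xN (e : R) : `|e| = 1 -> `|(e / `|x|) *: x| <= 1.
  by move=> e1; rewrite normrZ normrM e1 mul1r gtr0_norm ?invr_gt0// mulVf ?gt_eqF.
have := uC _ (xN 1 (normr1 _)); have := uC _ (xN (-1) ltac:(by rewrite normrN normr1)).
rewrite !uZ mulN1r mul1r mulNr !(mulrC `|x|^-1) -ler_pdivrMr// -{3}(gtr0_norm nx).
by rewrite -normf_div ler_norml; lra.
Qed.

End DualSpace.

(** * Quadratic penalties on [X] and convexity of the conditions *)

Section Approximation.
Context {R : realType} {X : normedModType R}.
Implicit Types (T : @opX R X) (f g a b u : X -> R) (x y w : X) (z : (X -> R) -> R).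

(** Young's inequality. For [l = 0] the quotient is 0 by the convention on division, so the
    constraint [y = x] has to be stated separately. *)
Lemma quad_le_embed (l : R) x y : 0 <= l -> (l = 0 -> y = x) ->
  quad_le l (fun h => h y - h x) (`|y - x| ^+ 2 / (2 * l)).
Proof.
move=> l0 lxy h hd; rewrite -(dualB h)//.
have n0 := dual_norm_ge0 h hd.
have [l_eq0|l_neq0] := eqVneq l 0.
  by rewrite lxy// subrr (dual0 h)// normr0 l_eq0 !mul0r expr2 mulr0 mul0r addr0.
have lp : 0 < l by rewrite lt_def l_neq0.
have := dnorm_bound_le h (y - x) hd; set d := `|y - x|.
have : 0 <= (l * dnorm h - d) ^+ 2 / (2 * l).
  by rewrite divr_ge0 ?sqr_ge0// mulr_ge0.
have -> : (l * dnorm h - d) ^+ 2 / (2 * l) = l / 2 * dnorm h ^+ 2 + d ^+ 2 / (2 * l) - dnorm h * d.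
  by field.
by lra.
Qed.

(** The bound without [e] is the infimum over [d], approached at [- (l |u|) v] with [v] an almost
    norming vector of [u]. *)
Lemma quad_near_min (l : R) u (e : R) : 0 <= l -> is_dual u -> 0 < e ->
  exists2 d, (l = 0 -> d = 0) & `|d| ^+ 2 / (2 * l) + u d <= - (l / 2 * dnorm u ^+ 2) + e.
Proof.
move=> l0 ud e0; have n0 := dual_norm_ge0 u ud.
have [l_eq0|l_neq0] := eqVneq l 0.
  by exists 0 => //; rewrite (dual0 u)// normr0 l_eq0 expr2 !mul0r; lra.
have lp : 0 < l by rewrite lt_def l_neq0.
have K0 : 0 < l * dnorm u + 1 by rewrite ltr_wpDl// mulr_ge0.
have [v v1 uv] := dnorm_adherent u _ ud (divr_gt0 e0 K0).
exists (- (l * dnorm u) *: v) => [le|]; first by rewrite le eqxx in l_neq0.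
rewrite (dualZ u)// normrZ normrN ger0_norm ?mulr_ge0//.
have v2 : (l * dnorm u * `|v|) ^+ 2 / (2 * l) <= l / 2 * dnorm u ^+ 2.
  have -> : (l * dnorm u * `|v|) ^+ 2 / (2 * l) = l / 2 * dnorm u ^+ 2 * `|v| ^+ 2 by field.
  rewrite -[leRHS]mulr1; apply: ler_wpM2l; last by rewrite expr_le1.
  by rewrite mulr_ge0 ?sqr_ge0//; lra.
have : l * dnorm u * (dnorm u - e / (l * dnorm u + 1)) <= l * dnorm u * u v.
  by apply: ler_wpM2l; [exact: mulr_ge0|exact: ltW].
have : l * dnorm u * (e / (l * dnorm u + 1)) <= e.
  rewrite mulrCA -[leRHS]mulr1; apply: ler_wpM2l; first exact: ltW.
  by rewrite ler_pdivrMr// mul1r; lra.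
set k := e / _; move: v2; rewrite !mulrBr !expr2 !mulrA; lra.
Qed.

Lemma fitz_le_graph T w b : monotone_op T -> T (w, b) -> fitz_le T (embed w) b (b w).
Proof.
move=> [Td Tm] Tw v c Tv; have := Tm _ _ _ _ Tw Tv.
rewrite (dualB b); last exact: Td _ Tw.
rewrite (dualB c); last exact: Td _ Tv.
by rewrite /embed; lra.
Qed.

Lemma fitz_le_conv T x a (r : R) x' a' (r' : R) (t : R) : dual_op T -> 0 < t < 1 ->
  fitz_le T (embed x) a r -> fitz_le T (embed x') a' r' ->
  fitz_le T (embed (t *: x + (1 - t) *: x')) (fun v => t * a v + (1 - t) * a' v)
    (t * r + (1 - t) * r').
Proof.
move=> Td t01 xr xr' w b Tw; have bd : is_dual b := Td _ Tw.
have := convex_combine_le _ _ _ _ _ t01 (xr _ _ Tw) (xr' _ _ Tw).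
by rewrite /embed (dualD b)// !(dualZ b)// !(mulrDr, mulrBr, mulrDl, mulrBl); lra.
Qed.

Lemma quad_le_conv (l : R) y x (s : R) y' x' (s' : R) (t : R) : 0 < t < 1 ->
  quad_le l (fun h => h y - h x) s -> quad_le l (fun h => h y' - h x') s' ->
  quad_le l (fun h => h (t *: y + (1 - t) *: y') - h (t *: x + (1 - t) *: x'))
    (t * s + (1 - t) * s').
Proof.
move=> t01 ys ys' h hd.
have := convex_combine_le _ _ _ _ _ t01 (ys _ hd) (ys' _ hd).
by rewrite !(dualD h)// !(dualZ h)// !(mulrDr, mulrBr, mulrDl, mulrBl); lra.
Qed.

Lemma dquad_le_conv (l : R) a (q : R) a' (q' : R) (t : R) : 0 < t < 1 ->
  dquad_le l a q -> dquad_le l a' q' ->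
  dquad_le l (fun x => t * a x + (1 - t) * a' x) (t * q + (1 - t) * q').
Proof.
move=> t01 aq aq' x; have := convex_combine_le _ _ _ _ _ t01 (aq x) (aq' x).
by rewrite !(mulrDr, mulrBr, mulrDl, mulrBl); lra.
Qed.

Lemma norm_sqr_conv (t : R) x y : 0 < t < 1 ->
  `|t *: x + (1 - t) *: y| ^+ 2 <= t * `|x| ^+ 2 + (1 - t) * `|y| ^+ 2.
Proof.
move=> t01; have H := normr_conv x y t t01; case/andP: t01 => t0 t1.
apply: (@le_trans _ _ ((t * `|x| + (1 - t) * `|y|) ^+ 2)).
  rewrite lerXn2r ?nnegrE//.
  by apply: addr_ge0; apply: mulr_ge0 => //; lra.
have : 0 <= t * (1 - t) * (`|x| - `|y|) ^+ 2.
  by rewrite mulr_ge0 ?sqr_ge0// mulr_ge0//; lra.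
by rewrite !expr2 !(mulrDl, mulrDr, mulrBl, mulrBr); lra.
Qed.

End Approximation.

(** * The Hahn-Banach estimate *)

Section ApproximateSolvability.
Context {R : realType} {X : normedModType R}.
Context {T1 T2 : @opX R X} {l m : R} {f : X -> R} {x : X}.
Context (l0 : 0 <= l) (m0 : 0 <= m) (lm : 0 < l + m).
Context (Tm1 : monotone_op T1) (TN1 : negative_infimum T1).
Context (Tm2 : monotone_op T2) (TN2 : negative_infimum T2).
Context (fd : is_dual f).

Local Notation D := (@dual_space R X).
Local Notation V := ((X * D) * (X * D))%type.

Lemma dual_space_conv (a a' : D) (t : R) :
  (t *: a + (1 - t) *: a' : D) = (fun v => t * a v + (1 - t) * a' v) :> (X -> R).
Proof. by []. Qed.

Lemma pair_conv (w w' : V) (t : R) : [/\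
  (t *: w + (1 - t) *: w').1.1 = t *: w.1.1 + (1 - t) *: w'.1.1,
  (t *: w + (1 - t) *: w').1.2 = t *: w.1.2 + (1 - t) *: w'.1.2,
  (t *: w + (1 - t) *: w').2.1 = t *: w.2.1 + (1 - t) *: w'.2.1 &
  (t *: w + (1 - t) *: w').2.2 = t *: w.2.2 + (1 - t) *: w'.2.2].
Proof. by []. Qed.

Definition fitz_epi (w : V) (r : R) : Prop :=
  exists r1 r2, [/\ fitz_le T1 (embed w.1.1) w.1.2 r1,
    fitz_le T2 (embed w.2.1) w.2.2 r2 & r1 + r2 <= r].

(** All terms of the estimate other than the two Fitzpatrick functions, as a function of their
    arguments; [y] is minimized out. *)
Definition penalty_epi (s : V) (r : R) : Prop :=
  exists y s1 s2 q1 q2, [/\ quad_le l (fun h => h y - h s.1.1) s1,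
    quad_le m (fun h => h y - h s.2.1) s2,
    dquad_le l s.1.2 q1, dquad_le m s.2.2 q2 &
    s1 + s2 + q1 + q2 - (s.1.2 x + s.2.2 x) - f y + f x + 2^-1 * `|y - x| ^+ 2
      + 2^-1 * dnorm (fun v => (s.1.2 v + s.2.2 v) - f v) ^+ 2 <= r].

Lemma fitz_epi_convex : convex_epi fitz_epi.
Proof.
move=> w r w' r' t t01 [r1 [r2 [F1 F2 le]]] [r1' [r2' [F1' F2' le']]].
have [E11 E12 E21 E22] := pair_conv w w' t.
exists (t * r1 + (1 - t) * r1'), (t * r2 + (1 - t) * r2'); split.
- by rewrite E11 E12 dual_space_conv; apply: fitz_le_conv => //; exact: Tm1.1.
- by rewrite E21 E22 dual_space_conv; apply: fitz_le_conv => //; exact: Tm2.1.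
- by have := convex_combine_le _ _ _ _ _ t01 le le'; lra.
Qed.

Lemma penalty_epi_convex : convex_epi penalty_epi.
Proof.
move=> s r s' r' t t01 [y [s1 [s2 [q1 [q2 [S1 S2 Q1 Q2 le]]]]]].
move=> [y' [s1' [s2' [q1' [q2' [S1' S2' Q1' Q2' le']]]]]].
have := pair_conv s s' t; set W := t *: s + _; clearbody W => -[E11 E12 E21 E22].
exists (t *: y + (1 - t) *: y'), (t * s1 + (1 - t) * s1'), (t * s2 + (1 - t) * s2'),
  (t * q1 + (1 - t) * q1'), (t * q2 + (1 - t) * q2').
split.
- by rewrite E11; exact: quad_le_conv.
- by rewrite E21; exact: quad_le_conv.
- by rewrite E12 dual_space_conv; exact: dquad_le_conv.
- by rewrite E22 dual_space_conv; exact: dquad_le_conv.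
have n1 : `|t *: y + (1 - t) *: y' - x| ^+ 2 <= t * `|y - x| ^+ 2 + (1 - t) * `|y' - x| ^+ 2.
  have -> : t *: y + (1 - t) *: y' - x = t *: (y - x) + (1 - t) *: (y' - x).
    by rewrite !scalerBr addrACA -opprD -scalerDl [t + _]addrC subrK scale1r.
  exact: norm_sqr_conv.
have ad := dual_spaceP s.1.2; have bd := dual_spaceP s.2.2.
have ad' := dual_spaceP s'.1.2; have bd' := dual_spaceP s'.2.2.
have n2 := dnorm_sqr_conv t _ _ t01 (dual_sub _ _ (dual_add _ _ ad bd) fd)
  (dual_sub _ _ (dual_add _ _ ad' bd') fd).
have Ef : f (t *: y + (1 - t) *: y') = t * f y + (1 - t) * f y'.
  by rewrite (dualD f)// !(dualZ f).
rewrite Ef E12 E22 (dual_space_conv s.1.2) (dual_space_conv s.2.2).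
have E : (fun v => (t * s.1.2 v + (1 - t) * s'.1.2 v + (t * s.2.2 v + (1 - t) * s'.2.2 v)) - f v)
    = (fun v => t * (s.1.2 v + s.2.2 v - f v) + (1 - t) * (s'.1.2 v + s'.2.2 v - f v)).
  by apply/funext => v; ring.
rewrite E; apply: le_trans (convex_combine_le _ _ _ _ _ t01 le le').
by move: n1 n2; lra.
Qed.

Lemma penalty_epi_bounded (K : R) : 0 <= K -> exists C : R, forall s : V,
  `|s.1.1| <= K -> `|s.2.1| <= K -> dnorm (s.1.2 : X -> R) <= K ->
  dnorm (s.2.2 : X -> R) <= K -> penalty_epi s C.
Proof.
move=> K0.
exists ((2 * K) ^+ 2 / (2 * l) + (2 * K) ^+ 2 / (2 * m) + l / 2 * K ^+ 2 + m / 2 * K ^+ 2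
  + 2 * K * `|x| + dnorm f * K + dnorm f * `|x| + 2^-1 * (K + `|x|) ^+ 2
  + 2^-1 * (2 * K + dnorm f) ^+ 2) => s s1 s2 a1 a2.
have ad := dual_spaceP s.1.2; have bd := dual_spaceP s.2.2.
have an0 := dual_norm_ge0 _ ad; have bn0 := dual_norm_ge0 _ bd; have fn0 := dual_norm_ge0 _ fd.
(* A zero parameter forces [y] to be the corresponding base point. At most one of [l] and [m] is
   zero, so this choice satisfies whichever constraint is active. *)
pose y := if l == 0 then s.1.1 else s.2.1.
have yK : `|y| <= K by rewrite /y; case: ifP.
have yle u : `|u| <= K -> `|y - u| ^+ 2 <= (2 * K) ^+ 2.
  move=> uK; rewrite lerXn2r ?nnegrE ?mulr_ge0//.
  by apply: le_trans (ler_normB _ _) _; lra.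
exists y, (`|y - s.1.1| ^+ 2 / (2 * l)), (`|y - s.2.1| ^+ 2 / (2 * m)),
  (l / 2 * dnorm (s.1.2 : X -> R) ^+ 2), (m / 2 * dnorm (s.2.2 : X -> R) ^+ 2).
split.
- by apply: quad_le_embed => // le; rewrite /y le eqxx.
- apply: quad_le_embed => // me; rewrite /y.
  by case: eqP => // le; move: lm; rewrite le me addr0 ltxx.
- by apply/dquad_leP.
- by apply/dquad_leP.
have div_le (k A B : R) : 0 <= k -> A <= B -> A / (2 * k) <= B / (2 * k).
  by move=> k0 AB; apply: ler_wpM2r => //; rewrite invr_ge0 mulr_ge0.
have e1 := div_le _ _ _ l0 (yle _ s1); have e2 := div_le _ _ _ m0 (yle _ s2).
have sqr_le (A B : R) : 0 <= A -> A <= B -> A ^+ 2 <= B ^+ 2.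
  by move=> A0 AB; rewrite lerXn2r ?nnegrE//; exact: le_trans AB.
have e3 : l / 2 * dnorm (s.1.2 : X -> R) ^+ 2 <= l / 2 * K ^+ 2.
  by apply: ler_wpM2l; [rewrite divr_ge0|exact: sqr_le].
have e4 : m / 2 * dnorm (s.2.2 : X -> R) ^+ 2 <= m / 2 * K ^+ 2.
  by apply: ler_wpM2l; [rewrite divr_ge0|exact: sqr_le].
have e5 : `|y - x| ^+ 2 <= (K + `|x|) ^+ 2.
  by apply: sqr_le => //; apply: le_trans (ler_normB _ _) _; lra.
have e6 : dnorm (fun v => (s.1.2 v + s.2.2 v) - f v) ^+ 2 <= (2 * K + dnorm f) ^+ 2.
  apply: sqr_le; first by apply: dual_norm_ge0; exact: dual_sub (dual_add _ _ ad bd) fd.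
  apply: le_trans (dual_normB _ _ (dual_add _ _ ad bd) fd) _.
  by have := dual_normD _ _ ad bd; lra.
have e7 : - s.1.2 x <= K * `|x|.
  apply: le_trans (ler_norm _) _; rewrite normrN.
  by apply: le_trans (dnorm_bound _ x ad) _; exact: ler_wpM2r.
have e8 : - s.2.2 x <= K * `|x|.
  apply: le_trans (ler_norm _) _; rewrite normrN.
  by apply: le_trans (dnorm_bound _ x bd) _; exact: ler_wpM2r.
have e9 : - f y <= dnorm f * K.
  apply: le_trans (ler_norm _) _; rewrite normrN.
  by apply: le_trans (dnorm_bound _ y fd) _; exact: ler_wpM2l.
have e10 := dnorm_bound_le f x fd.
by clear -e1 e2 e3 e4 e5 e6 e7 e8 e9 e10; lra.
Qed.

(** Otherwise the Fitzpatrick sum and the penalty add up to at least [eta] everywhere and are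
    separated by a functional with components [u1], [u2] in [X^*] and [Z1], [Z2] in [X^**]. The
    negative infimum property at [(Z1, u1)] and [(Z2, u2)] yields graph points that violate the
    separation. *)
Lemma sum_approx (eta : R) : 0 < eta -> exists y g (c : R),
  [/\ is_dual g, sum_le T1 T2 l m y g c &
    c - g x - f y + f x + 2^-1 * `|y - x| ^+ 2 + 2^-1 * dnorm (fun v => g v - f v) ^+ 2 <= eta].
Proof.
move=> eta0; apply: contrapT => nex.
have Tg1 w b : T1 (w, b) -> is_dual b by move=> Tw; exact: (Tm1.1 _ Tw).
have Tg2 w b : T2 (w, b) -> is_dual b by move=> Tw; exact: (Tm2.1 _ Tw).
have fitzP w1 b1 (bd1 : is_dual b1) w2 b2 (bd2 : is_dual b2) : T1 (w1, b1) -> T2 (w2, b2) ->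
    fitz_epi ((w1, to_dual_space b1 bd1), (w2, to_dual_space b2 bd2)) (b1 w1 + b2 w2).
  by move=> Tw1 Tw2; exists (b1 w1), (b2 w2); split=> //; exact: fitz_le_graph.
have [w1 [b1 Tw1]] := negative_infimum_nonempty _ TN1.
have [w2 [b2 Tw2]] := negative_infimum_nonempty _ TN2.
have E0 := fitzP _ _ (Tg1 _ _ Tw1) _ _ (Tg2 _ _ Tw2) Tw1 Tw2.
have [|||||L Ll LP] := @convex_sandwich R V fitz_epi penalty_epi eta.
- exact: fitz_epi_convex.
- exact: penalty_epi_convex.
- by eexists; eexists; exact: E0.
- move=> v; pose K := `|v.1.1| + `|v.2.1| + dnorm (v.1.2 : X -> R) + dnorm (v.2.2 : X -> R).
  have an0 := dual_norm_ge0 _ (dual_spaceP v.1.2).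
  have bn0 := dual_norm_ge0 _ (dual_spaceP v.2.2).
  have n1 := normr_ge0 v.1.1; have n2 := normr_ge0 v.2.1.
  have [|C CP] := penalty_epi_bounded K; first by rewrite /K; lra.
  by exists C; apply: CP; rewrite /K; lra.
- move=> w r r' [r1 [r2 [F1 F2 le]]] [y [s1 [s2 [q1 [q2 [S1 S2 Q1 Q2 le']]]]]].
  rewrite leNgt; apply/negP => lt; apply: nex.
  have ad := dual_spaceP w.1.2; have bd := dual_spaceP w.2.2.
  exists y, (fun v => w.1.2 v + w.2.2 v), ((r1 + s1 + q1) + (r2 + s2 + q2)).
  split; [exact: dual_add| |by lra].
  exists w.1.2, w.2.2, (r1 + s1 + q1), (r2 + s2 + q2); split=> //.
  + by exists (embed w.1.1), r1, s1, q1; split=> //; split=> //; exact: embed_bidual.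
  + by exists (embed w.2.1), r2, s2, q2; split=> //; split=> //; exact: embed_bidual.
have L0 : L 0 = 0 by have := Ll 1 0 0; rewrite scale1r addr0; lra.
have LD u v : L (u + v) = L u + L v by have := Ll 1 u v; rewrite scale1r mul1r.
have LN v : L (- v) = - L v by have := Ll (-1) v 0; rewrite scaleN1r !addr0 L0; lra.
have [C1 C1P] := penalty_epi_bounded 1 ler01.
pose C := b1 w1 + b2 w2 + C1 - eta
  - L ((w1, to_dual_space b1 (Tg1 _ _ Tw1)), (w2, to_dual_space b2 (Tg2 _ _ Tw2))).
have LC s : penalty_epi s C1 -> - L s <= C.
  by move=> /(LP _ _ _ _ E0); rewrite /C; lra.
have dn0 : dnorm ((0 : D) : X -> R) <= 1.
  by apply: dnorm_le => // v; rewrite normr0 mul1r.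
have dnN (a : D) : dnorm (a : X -> R) <= 1 -> dnorm ((- a : D) : X -> R) <= 1.
  move=> a1; have := dual_normZ_le (-1) _ (dual_spaceP a); rewrite normrN normr1 mul1r.
  by under eq_fun do rewrite mulN1r; move=> /le_trans; apply.
have n01 : `|0 : X| <= 1 by rewrite normr0.
pose u1 z := L ((z, 0), 0); pose u2 z := L (0, (z, 0)).
pose U1 a := L ((0, a), 0); pose U2 a := L (0, (0, a)).
have LE z1 (a1 : D) z2 (a2 : D) : L ((z1, a1), (z2, a2)) = u1 z1 + U1 a1 + u2 z2 + U2 a2.
  rewrite /u1 /u2 /U1 /U2 -!LD; congr L.
  by congr (_, _); congr (_, _); rewrite /= ?addr0 ?add0r.
have ud1 : is_dual u1.
  apply: (@dual_of_unit_bound _ _ C) => [t v v'|v v1].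
    rewrite /u1 -Ll; congr L; congr (_, _); last by rewrite /= scaler0 addr0.
    by congr (_, _); rewrite /= scaler0 addr0.
  rewrite /u1 -[L _]opprK -LN; apply: LC; apply: C1P => //=; rewrite ?oppr0//.
  by rewrite normrN.
have ud2 : is_dual u2.
  apply: (@dual_of_unit_bound _ _ C) => [t v v'|v v1].
    rewrite /u2 -Ll; congr L; congr (_, _); first by rewrite /= scaler0 addr0.
    by congr (_, _); rewrite /= scaler0 addr0.
  rewrite /u2 -[L _]opprK -LN; apply: LC; apply: C1P => //=; rewrite ?oppr0//.
  by rewrite normrN.
have [|a a1|Z1 Zd1 ZE1] := @extend_bidual R X U1 C.
- move=> t v v'; rewrite /U1 -Ll; congr L; congr (_, _); last by rewrite /= scaler0 addr0.
  by congr (_, _); rewrite /= scaler0 addr0.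
- rewrite /U1 -[L _]opprK -LN; apply: LC; apply: C1P => //=; rewrite ?oppr0//.
  exact: dnN.
have [|a a1|Z2 Zd2 ZE2] := @extend_bidual R X U2 C.
- move=> t v v'; rewrite /U2 -Ll; congr L; congr (_, _); first by rewrite /= scaler0 addr0.
  by congr (_, _); rewrite /= scaler0 addr0.
- rewrite /U2 -[L _]opprK -LN; apply: LC; apply: C1P => //=; rewrite ?oppr0//.
  exact: dnN.
(* Five errors [e] will occur, two from the negative infima and three from near minimizers; they
   total half of [eta]. *)
pose e := eta / 10; have e0 : 0 < e by rewrite /e; lra.
have [y1 [g1 [Ty1 N1]]] := TN1 Z1 u1 Zd1 ud1 e e0.
have [y2 [g2 [Ty2 N2]]] := TN2 Z2 u2 Zd2 ud2 e e0.
have gd1 := Tg1 _ _ Ty1; have gd2 := Tg2 _ _ Ty2.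
rewrite bidualB// in N1; rewrite bidualB// in N2.
have E1 := fitzP _ _ gd1 _ _ gd2 Ty1 Ty2.
have [d1 d1l D1] := quad_near_min l u1 e l0 ud1 e0.
have [d2 d2m D2] := quad_near_min m u2 e m0 ud2 e0.
have vd := dual_sub _ _ (dual_add _ _ ud1 ud2) fd.
have [d _ D3] := quad_near_min 1 _ e ler01 vd e0.
pose y := x + d.
(* The dual arguments are [u1] and [u2] themselves, so that the unknown numbers [Z1 u1] and [Z2 u2]
   cancel against those in the negative infima. What remains splits into three quadratic problems,
   in [d1], [d2] and [d], each nearly 0. *)
have P : penalty_epi ((y + d1, to_dual_space u1 ud1), (y + d2, to_dual_space u2 ud2))
    (`|d1| ^+ 2 / (2 * l) + `|d2| ^+ 2 / (2 * m) + l / 2 * dnorm u1 ^+ 2 + m / 2 * dnorm u2 ^+ 2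
     - (u1 x + u2 x) - f y + f x + 2^-1 * `|d| ^+ 2
     + 2^-1 * dnorm (fun v => (u1 v + u2 v) - f v) ^+ 2).
  exists y, (`|d1| ^+ 2 / (2 * l)), (`|d2| ^+ 2 / (2 * m)), (l / 2 * dnorm u1 ^+ 2),
    (m / 2 * dnorm u2 ^+ 2); split=> /=.
  - have -> : `|d1| = `|y - (y + d1)| by rewrite opprD addrA subrr sub0r normrN.
    by apply: quad_le_embed => // /d1l ->; rewrite addr0.
  - have -> : `|d2| = `|y - (y + d2)| by rewrite opprD addrA subrr sub0r normrN.
    by apply: quad_le_embed => // /d2m ->; rewrite addr0.
  - by apply/dquad_leP.
  - by apply/dquad_leP.
  - by rewrite /y [x + d]addrC addrK.
have := LP _ _ _ _ E1 P; rewrite !LE -!ZE1 -!ZE2 /=.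
move: D3; rewrite /y !(dualD u1)// !(dualD u2)// (dualD f)//.
rewrite mulr1.
have eE : eta = 10 * e by rewrite /e; field.
clearbody u1 u2 U1 U2 e.
by clear -N1 N2 D1 D2 eE e0; lra.
Qed.

End ApproximateSolvability.

(** * From approximate to exact contact points *)

Section BrondstedRockafellar.
Context {R : realType} {X : completeNormedModType R}.
Context {T1 T2 : @opX R X} {l m : R}.
Context (l0 : 0 <= l) (m0 : 0 <= m) (lm : 0 < l + m).
Context (Tm1 : monotone_op T1) (TN1 : negative_infimum T1).
Context (Tm2 : monotone_op T2) (TN2 : negative_infimum T2).
Local Notation S := (sum_le T1 T2 l m).

(** In the estimate of [sum_approx], the quadratic terms absorb [(g - f) (y - x)], which gives the
    new gap [eta]. For the distance, the value at the midpoint of [(x, f)] and [(y, g)] is at least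
    the pairing there; by convexity this bounds [c'] from below and leaves a quarter of the squared
    distance below [e + eta]. *)
Lemma sum_step (x : X) f (c e eta : R) : is_dual f -> S x f c -> c <= f x + e -> 0 < eta ->
  exists y g (c' : R), [/\ is_dual g, S y g c', c' <= g y + eta &
    `|y - x| ^+ 2 + dnorm (fun v => g v - f v) ^+ 2 <= 4 * (e + eta)].
Proof.
move=> fd Sx ce eta0.
have [y [g [c' [gd Sy le]]]] := @sum_approx R X T1 T2 l m f x l0 m0 lm Tm1 TN1 Tm2 TN2 fd eta eta0.
exists y, g, c'; split=> //.
- have gfd := dual_sub _ _ gd fd; have := dnorm_bound _ (y - x) gfd.
  rewrite (dualB g)// (dualB f)// ler_norml => /andP[h _].
  have := sqr_ge0 (dnorm (fun v => g v - f v) - `|y - x|).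
  by rewrite sqrrB; lra.
- have t01 : 0 < (2^-1 : R) < 1 by lra.
  have := sum_convex _ _ _ _ _ _ _ _ _ _ _ l0 m0 t01 Sx Sy.
  move=> /(sum_ge _ _ _ _ _ _ _ l0 m0 Tm1.1 TN1 Tm2.1 TN2).
  rewrite !(dualD g)// !(dualD f)// !(dualZ g)// !(dualZ f)// => mid.
  have gfd := dual_sub _ _ gd fd; have := dnorm_bound _ (y - x) gfd.
  rewrite (dualB g)// (dualB f)// ler_norml => /andP[h _].
  have := sqr_ge0 (dnorm (fun v => g v - f v) - `|y - x|).
  by rewrite sqrrB; lra.
Qed.

End BrondstedRockafellar.

Lemma cvg_of_tail_bound {R : realType} {W : completeNormedModType R}
    (u : nat -> W) (r : nat -> R) :
  r @ \oo --> (0 : R) -> (forall n k, `|u (n + k)%N - u n| <= r n) ->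
  exists2 v : W, u @ \oo --> v & forall n, `|u n - v| <= r n.
Proof.
move=> r0 ur.
have tail n : \forall k \near \oo, `|u k - u n| <= r n.
  by exists n => // k /= nk; rewrite -(subnKC nk).
have : cvg (u @ \oo).
  apply: cauchy_cvg; apply: cauchy_exP => e e0.
  have /cvgrPdist_lt /(_ e e0) [N _ rN] := r0.
  exists (u N); have := tail N; apply: filterS => k uk /=.
  rewrite -ball_normE /= distrC; apply: le_lt_trans uk _.
  by have := rN N (leqnn N); rewrite /= sub0r normrN; apply: le_lt_trans; exact: ler_norm.
move=> /cvg_ex[v uv]; exists v => // n; apply/ler_addgt0Pr => e e0.
have /cvgrPdist_lt /(_ e e0) uve := uv.
have [k [ke kn]] := filter_ex (filterI uve (tail n)).
have -> : u n - v = - (u k - u n) - (v - u k) by rewrite !opprB addrA subrK.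
apply: le_trans (ler_normB _ _) _; rewrite normrN.
by apply: lerD => //; exact: ltW.
Qed.

Section BrondstedRockafellarLimit.
Context {R : realType} {X : completeNormedModType R}.
Context {T1 T2 : @opX R X} {l m : R}.
Context (l0 : 0 <= l) (m0 : 0 <= m) (lm : 0 < l + m).
Context (Tm1 : monotone_op T1) (TN1 : negative_infimum T1).
Context (Tm2 : monotone_op T2) (TN2 : negative_infimum T2).
Local Notation S := (sum_le T1 T2 l m).

(** With gap [d n ^+ 2] and [d n = e / 2^n], one step moves by at most the square root of
    [4 (1 + 1/4) d n ^+ 2], hence by less than [3 * d n]; these lengths sum to [6 * e]. The limit is
    a contact point because [S] is closed. *)
Lemma sum_exact_near (x : X) f (c e : R) : is_dual f -> S x f c -> 0 < e ->
  c <= f x + e ^+ 2 ->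
  exists y g, [/\ is_dual g, S y g (g y), `|y - x| <= 6 * e &
    dnorm (fun v => g v - f v) <= 6 * e].
Proof.
move=> fd Sx e0 ce; pose d n : R := e * 2^-1 ^+ n.
have d0 n : 0 < d n by rewrite mulr_gt0 ?exprn_gt0.
have dS n : d n.+1 = d n / 2 by rewrite /d exprS; field.
pose inv n (p : X * (X -> R) * R) :=
  [/\ is_dual p.1.2, S p.1.1 p.1.2 p.2 & p.2 <= p.1.2 p.1.1 + d n ^+ 2].
(* The step function must be total for the recursion; where the invariant fails it returns its
   argument. *)
have /choice[F FP] (q : nat * (X * (X -> R) * R)) : exists p, inv q.1 q.2 ->
    [/\ inv q.1.+1 p, `|p.1.1 - q.2.1.1| <= 3 * d q.1 &
     dnorm (fun v => p.1.2 v - q.2.1.2 v) <= 3 * d q.1].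
  have [iq|] := pselect (inv q.1 q.2); last by exists q.2.
  have [gd Sq le] := iq.
  have [y [g [c' [g'd Sy le' dist]]]] :=
    sum_step l0 m0 lm Tm1 TN1 Tm2 TN2 _ _ _ _ (d q.1.+1 ^+ 2) gd Sq le (exprn_gt0 _ (d0 _)).
  exists ((y, g), c') => _; split=> //=.
  - have dd := d0 q.1; move: dist; rewrite dS !expr2 => dist.
    have : `|y - q.2.1.1| ^+ 2 <= (3 * d q.1) ^+ 2.
      have := sqr_ge0 (dnorm (fun v => g v - q.2.1.2 v)).
      have := sqr_ge0 (d q.1); rewrite !expr2; lra.
    by rewrite ler_pXn2r ?nnegrE//; lra.
  - have dd := d0 q.1; move: dist; rewrite dS !expr2 => dist.
    have : dnorm (fun v => g v - q.2.1.2 v) ^+ 2 <= (3 * d q.1) ^+ 2.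
      have := sqr_ge0 `|y - q.2.1.1|.
      have := sqr_ge0 (d q.1); rewrite !expr2; lra.
    by rewrite ler_pXn2r ?nnegrE//; [apply: dual_norm_ge0; exact: dual_sub|lra].
pose P := fix P n := if n is k.+1 then F (k, P k) else ((x, f), c).
have Pinv n : inv n (P n).
  elim: n => [|n IH]; first by split=> //=; rewrite /d expr0 mulr1.
  by have [] := FP (n, P n) IH.
pose Y n := (P n).1.1; pose G n := (P n).1.2.
have Gd n : is_dual (G n) by have [] := Pinv n.
have Ystep n : `|Y n.+1 - Y n| <= 3 * d n by have [] := FP (n, P n) (Pinv n).
have Gstep n : dnorm (fun v => G n.+1 v - G n v) <= 3 * d n by have [] := FP (n, P n) (Pinv n).
have Ytail n k : `|Y (n + k)%N - Y n| <= 6 * d n - 6 * d (n + k)%N.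
  elim: k => [|k IH]; first by rewrite addn0 !subrr normr0.
  have := ler_normD (Y (n + k).+1 - Y (n + k)%N) (Y (n + k)%N - Y n).
  rewrite addrA subrK addnS; have := Ystep (n + k)%N.
  by rewrite (dS (n + k)%N); lra.
have Gtail n k : dnorm (fun v => G (n + k)%N v - G n v) <= 6 * d n - 6 * d (n + k)%N.
  elim: k => [|k IH].
    rewrite addn0 subrr; apply: dnorm_le => // v; by rewrite subrr normr0 mul0r.
  have := dnorm_triangle _ _ _ (Gd (n + k).+1) (Gd (n + k)%N) (Gd n).
  rewrite addnS; have := Gstep (n + k)%N.
  by rewrite (dS (n + k)%N); lra.
have dcvg : d @ \oo --> (0 : R).
  by apply: cvg_geometric; rewrite ger0_norm; lra.
have [|n k|y Yy Yn] := @cvg_of_tail_bound R X Y (fun n => 6 * d n).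
- by rewrite -(mulr0 6); apply: cvgMr.
- by apply: le_trans (Ytail n k) _; have := d0 (n + k)%N; lra.
(* The limit in [X^*] is built pointwise; the error bound, linear in [|v|], then makes the
   convergence one in dual norm. *)
have /choice[g gP] v : exists gv : R, (fun n => G n v) @ \oo --> gv /\
    forall n, `|G n v - gv| <= 6 * d n * `|v|.
  have [|n k|gv h1 h2] := @cvg_of_tail_bound R R^o (fun n => G n v) (fun n => 6 * d n * `|v|).
  - by rewrite -(mul0r `|v|) -(mulr0 6); apply: cvgMl; apply: cvgMr.
  - have h := dual_sub _ _ (Gd (n + k)%N) (Gd n).
    apply: le_trans (dnorm_bound _ v h) _; apply: ler_wpM2r => //.
    by apply: le_trans (Gtail n k) _; have := d0 (n + k)%N; lra.
  - by exists gv.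
have glin (a : R) u v : g (a *: u + v) = a * g u + g v.
  have [h _] := gP (a *: u + v); apply: (cvg_unique _ h); first exact: Rhausdorff.
  have -> : (fun n => G n (a *: u + v)) = (fun n => a * G n u + G n v).
    by apply/funext => n; exact: (Gd n).1.
  by apply: cvgD; [apply: cvgMr; have [] := gP u|have [] := gP v].
have gd : is_dual g.
  apply: (@dual_of_bound _ _ (6 * d 0 + dnorm f)) => // v.
  have [_ /(_ 0%N)] := gP v; rewrite /G /= => h.
  have := dnorm_bound f v fd; have := ler_normB (f v) (f v - g v).
  by rewrite opprB addrC subrK mulrDl; lra.
have Gn n : dnorm (fun v => G n v - g v) <= 6 * d n.
  apply: dnorm_le => [|v]; first by have := d0 n; lra.
  by have [_] := gP v.
exists y, g; split=> //; last 2 first.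
- by have := Yn 0%N; rewrite /Y /= /d expr0 mulr1 distrC.
- by have := Gn 0%N; rewrite /G /= /d expr0 mulr1 dual_normBC.
have n1 := negative_infimum_nonempty _ TN1; have n2 := negative_infimum_nonempty _ TN2.
apply: sum_closed => //; [exact: Tm1.1|exact: Tm2.1|] => e' e'0.
pose K := 6 * (`|y| + 6 * e + dnorm g) + e + 7.
have K0 : 0 < K.
  have := normr_ge0 y; have := dual_norm_ge0 g gd; rewrite /K; lra.
have /cvgrPdist_lt /(_ (e' / K) (divr_gt0 e'0 K0)) [n _ /(_ n (leqnn n))] := dcvg.
rewrite /= sub0r normrN gtr0_norm// ltr_pdivlMr// => dK.
have dn := d0 n.
have de : d n <= e.
  by rewrite /d -[leRHS]mulr1 ler_pM2l// exprn_ile1//; lra.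
have Kd : 6 * d n < e'.
  apply: le_lt_trans dK; rewrite mulrC; apply: ler_wpM2l; first exact: ltW.
  by have := normr_ge0 y; have := dual_norm_ge0 g gd; rewrite /K; lra.
have [_ Sn cn] := Pinv n.
exists (Y n), (G n), (P n).2; split=> //.
- exact: le_lt_trans (Yn n) Kd.
- exact: le_lt_trans (Gn n) Kd.
apply: le_lt_trans cn _; rewrite -/(Y n) -/(G n).
have h1 := dnorm_bound_le _ (Y n) (dual_sub _ _ (Gd n) gd).
have h2 := dnorm_bound_le _ (Y n - y) gd; rewrite (dualB g)// in h2.
have Yb : `|Y n| <= `|y| + 6 * e.
  by have := ler_normD (Y n - y) y; rewrite subrK; have := Yn n; lra.
have h3 : dnorm (fun v => G n v - g v) * `|Y n| <= 6 * d n * (`|y| + 6 * e).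
  by apply: ler_pM => //; apply: dual_norm_ge0; exact: dual_sub.
have h4 : dnorm g * `|Y n - y| <= dnorm g * (6 * d n).
  by apply: ler_wpM2l => //; exact: dual_norm_ge0.
have h5 : d n ^+ 2 <= d n * e by rewrite expr2; apply: ler_wpM2l => //; exact: ltW.
move: dK; rewrite /K !mulrDr !mulrDl => dK.
by move: h1 h2 h3 h4 h5; rewrite !(mulrDr, mulrDl) => h1 h2 h3 h4 h5; lra.
Qed.

End BrondstedRockafellarLimit.

(** * The duality mapping as a contact set *)

Section DualityMapping.
Context {R : realType} {X : normedModType R}.
Implicit Types (T : @opX R X) (f g a b : X -> R) (x y w : X) (z : (X -> R) -> R).

(** The equality case of Fenchel-Young: the subgradient inequality is [dquad_le 1 g] with constant
    [g y - |y|^2 / 2], whose least admissible value is [|g|^2 / 2]. *)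
Lemma JdualP y g : is_dual g ->
  Jdual (y, g) <-> 2^-1 * `|y| ^+ 2 + 2^-1 * dnorm g ^+ 2 <= g y.
Proof.
move=> gd; split=> [[_ /= H]|H].
  have : dquad_le 1 g (g y - 2^-1 * `|y| ^+ 2).
    by move=> v; have := H v; rewrite (dualB g)//; lra.
  by move=> /(dquad_leP _ _ _ ler01 gd); lra.
split=> //= v; rewrite (dualB g)//; have := dnorm_bound_le g v gd.
by have := sqr_ge0 (dnorm g - `|v|); rewrite sqrrB; lra.
Qed.

Lemma Jdual_norm y g : is_dual g -> Jdual (y, g) -> `|y| = dnorm g.
Proof.
move=> gd /(JdualP _ _ gd) H; have := dnorm_bound_le g y gd.
have := sqr_ge0 (dnorm g - `|y|); rewrite sqrrB => h1 h2.
have : (dnorm g - `|y|) ^+ 2 = 0 by apply/le_anti/andP; split; rewrite ?sqr_ge0 ?sqrrB//; lra.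
by move=> /eqP; rewrite sqrf_eq0 subr_eq0 => /eqP.
Qed.

Lemma bounded_multiples_eq0 (v r : R) : (forall t : R, t * v <= r) -> v = 0.
Proof.
move=> vr; apply/eqP; apply: contraT => v0.
by have := vr ((r + 1) / v); rewrite divfK//; lra.
Qed.

(* For these two operators and [l = 1], [m = 0], the function [sum_le] is
   [|y|^2 / 2 + |g|^2 / 2], which represents the duality mapping. *)
Definition zero_normal_op : @opX R X := [set p | p.1 = 0 /\ is_dual p.2].
Definition zero_op : @opX R X := [set p | p.2 = (fun=> 0)].

Lemma zero_normal_op_monotone : monotone_op zero_normal_op.
Proof.
split=> [p []//|x f y g [/= -> fd] [/= -> gd]].
by rewrite subrr (dual0 f)// (dual0 g)// subrr.
Qed.

Lemma zero_op_monotone : monotone_op zero_op.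
Proof.
split=> [[x f] |x f y g]; rewrite /zero_op /=; first by move=> ->; exact: is_dual0.
by move=> -> ->; rewrite subrr.
Qed.

Lemma zero_normal_op_NI : negative_infimum zero_normal_op.
Proof.
move=> z f zd fd e e0; exists 0, f; split=> //.
by rewrite bidualB// !subrr; exact: ltW.
Qed.

Lemma zero_op_NI : negative_infimum zero_op.
Proof.
move=> z f zd fd e e0.
have E : z (fun x => f x - 0) = z f by under eq_fun do rewrite subr0.
have [f0|/existsNP[v fv]] := pselect (forall v, f v = 0).
  exists 0, (fun=> 0); split=> //; rewrite E f0 subr0.
  have -> : f = (fun=> 0) by apply/funext.
  by rewrite bidual0// subr0; exact: ltW.
exists ((z f / f v) *: v), (fun=> 0); split=> //; rewrite E subr0 (dualZ f)//.
by rewrite divfK ?subrr ?(ltW e0)//; apply/eqP.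
Qed.

(** The Fitzpatrick function of [zero_normal_op] is the indicator of [z = 0], that of [zero_op] the
    indicator of [a = 0]. So the first term carries all of [g] and both quadratics, and the second
    contributes nothing. *)
Lemma sum_le_Jdual y g (c : R) : is_dual g ->
  sum_le zero_normal_op zero_op 1 0 y g c <->
  2^-1 * `|y| ^+ 2 + 2^-1 * dnorm g ^+ 2 <= c.
Proof.
move=> gd; split; last first.
  move=> H; exists g, (fun=> 0), c, 0; split.
  - by split=> //; exact: is_dual0.
  - by apply/funext => x; rewrite addr0.
  - exists (embed 0), 0, (`|y - 0| ^+ 2 / (2 * 1)), (1 / 2 * dnorm g ^+ 2).
    split; last by rewrite subr0; lra.
    split; first exact: embed_bidual.
    + by move=> w b [/= -> bd]; rewrite /embed (dual0 g)// (dual0 b)//; lra.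
    + by apply: quad_le_embed => // /eqP; rewrite oner_eq0.
    + by apply/dquad_leP.
  - exists (embed y), 0, 0, 0; split; last by lra.
    split; first exact: embed_bidual.
    + by move=> w b; rewrite /zero_op /= => ->; rewrite /embed; lra.
    + by move=> f fd; rewrite /embed; lra.
    + by move=> x; lra.
  - by rewrite addr0.
move=> [a1 [a2 [c1 [c2 [[ad1 ad2] gE Y1 Y2 le]]]]].
have [z1 [r1 [s1 [q1 [[zd1 zr1 zs1 aq1] le1]]]]] := Y1.
have [z2 [r2 [s2 [q2 [[zd2 zr2 zs2 aq2] le2]]]]] := Y2.
have zr1' b : is_dual b -> z1 b <= r1.
  move=> bd; have := zr1 0 b (conj erefl bd).
  by rewrite (dual0 a1)// (dual0 b)//; lra.
have z1E b : is_dual b -> z1 b = 0.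
  move=> bd; apply: (@bounded_multiples_eq0 _ r1) => t.
  by rewrite -(bidualZ z1)//; apply: zr1'; exact: dual_scale.
have r10 : 0 <= r1 by rewrite -(bidual0 z1)//; apply: zr1'; exact: is_dual0.
have zr2' w : a2 w <= r2.
  by have := zr2 w (fun=> 0) erefl; rewrite bidual0//; lra.
have a2E w : a2 w = 0.
  by apply: (@bounded_multiples_eq0 _ r2) => t; rewrite -(dualZ a2).
have r20 : 0 <= r2 by rewrite -(a2E 0).
have s20 : 0 <= s2 by apply: quad_ge0 zs2; rewrite bidual0// subr0.
have q20 : 0 <= q2 by exact: dquad_ge0 aq2.
have ga : g = a1 by apply/funext => x; rewrite gE a2E addr0.
have := iffLR (dquad_leP _ _ _ ler01 ad1) aq1; rewrite -ga => gq.
have [u ud [u1 uy]] := norming_functional y.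
(* Testing at [|y| u], with [u] norming [y], gives [|y|^2 <= |y|^2 / 2 + s1]. *)
have := zs1 _ (dual_scale `|y| u ud); rewrite z1E; last exact: dual_scale.
have nu0 := dual_norm_ge0 _ (dual_scale `|y| u ud).
have : dnorm (fun x => `|y| * u x) ^+ 2 <= `|y| ^+ 2.
  rewrite lerXn2r ?nnegrE//; apply: le_trans (dual_normZ_le _ _ ud) _.
  by rewrite normr_id -[leRHS]mulr1; exact: ler_wpM2l.
by rewrite uy !expr2; lra.
Qed.

End DualityMapping.

(** * Elements of [tilde Jdual] as subgradients *)

Section TildeJ.
Context {R : realType} {X : completeNormedModType R}.
Implicit Types (T : @opX R X) (f g a b c : X -> R) (x y w : X) (z : (X -> R) -> R).

(** [sum_exact_near] is started at [(|g| v, g)] with [v] almost norming [g]; its displacement [6 e]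
    dictates [e = eta / 6]. *)
Lemma Jdual_range_dense g (eta : R) : is_dual g -> 0 < eta ->
  exists y g', [/\ is_dual g', Jdual (y, g') & dnorm (fun x => g' x - g x) <= eta].
Proof.
move=> gd eta0; pose e := eta / 6; have e0 : 0 < e by rewrite /e; lra.
have n0 := dual_norm_ge0 g gd.
have n1 : 0 < dnorm g + 1 by lra.
have [v v1 gv] := dnorm_adherent g _ gd (divr_gt0 (exprn_gt0 2 e0) n1).
have S : sum_le zero_normal_op zero_op 1 0 (dnorm g *: v) g
    (2^-1 * `|dnorm g *: v| ^+ 2 + 2^-1 * dnorm g ^+ 2) by apply/sum_le_Jdual.
have := @sum_exact_near R X zero_normal_op zero_op 1 0 ler01 (lexx 0) ltac:(lra)
  zero_normal_op_monotone zero_normal_op_NI zero_op_monotone zero_op_NI _ _ _ e gd S e0.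
case=> [|y [g' [g'd S' _ dist]]].
  rewrite (dualZ g)// normrZ ger0_norm//.
  have : (dnorm g * `|v|) ^+ 2 <= dnorm g ^+ 2.
    rewrite exprMn -[leRHS]mulr1; apply: ler_wpM2l; first exact: sqr_ge0.
    by rewrite expr_le1.
  have : dnorm g * (dnorm g - e ^+ 2 / (dnorm g + 1)) <= dnorm g * g v.
    by apply: ler_wpM2l => //; exact: ltW.
  have : dnorm g * (e ^+ 2 / (dnorm g + 1)) <= e ^+ 2.
    rewrite mulrCA -[leRHS]mulr1; apply: ler_wpM2l; first exact: sqr_ge0.
    by rewrite ler_pdivrMr// mul1r; lra.
  by set k := e ^+ 2 / _; rewrite mulrBr [dnorm g ^+ 2]expr2; lra.
exists y, g'; split=> //; last by move: dist; rewrite /e; lra.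
by apply/(JdualP _ _ g'd); apply/(sum_le_Jdual _ _ _ g'd).
Qed.

(* Monotonicity is tested at points of [J] whose second component is close to
   [c + t (f - c)]; then [t] tends to [0]. *)
Lemma tilde_Jdual_subgradient z c f : tilde Jdual (z, c) -> is_dual f ->
  z f - z c <= 2^-1 * dnorm f ^+ 2 - 2^-1 * dnorm c ^+ 2.
Proof.
move=> [/= zd [cd zJ]] fd; have [_ [C zC]] := zd.
have fcd := dual_sub _ _ fd cd.
pose K := dnorm (fun x => f x - c x); have K0 : 0 <= K := dual_norm_ge0 _ fcd.
pose n := dnorm c; have n0 : 0 <= n := dual_norm_ge0 _ cd.
have [M ME] : {M : R | M = n + K + 1} by exists (n + K + 1).
have [B BE] : {B : R | B = `|z f - z c| + n * (K + 1) + 2 * M + `|C|} by eexists.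
have key (t : R) : 0 < t < 1 ->
    z f - z c <= 2^-1 * dnorm f ^+ 2 - 2^-1 * n ^+ 2 + t * B.
  move=> /andP[t0 t1].
  have gd := dual_lincomb (1 - t) t c f cd fd; set g := fun x => _ in gd.
  (* The approximation error has to be of order [t^2], because the monotonicity inequality is going
     to be divided by [t]. *)
  have t20 : 0 < t ^+ 2 by rewrite exprn_gt0.
  have [y [g' [g'd Jy ge]]] := Jdual_range_dense g _ gd t20.
  have ed := dual_sub _ _ g'd gd; set e := fun x => _ in ge ed.
  have yn := Jdual_norm _ _ g'd Jy.
  have Jy' := iffLR (JdualP _ _ g'd) Jy.
  have := zJ _ _ Jy; rewrite (bidualB z)// => mon.
  have zg' : z g' = (1 - t) * z c + t * z f + z e.
    have := bidualB z g' g zd g'd gd; rewrite -/e => ->.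
    by rewrite /g (bidual_lin z)//; ring.
  have ze : - z e <= t ^+ 2 * `|C|.
    apply: le_trans (ler_norm _) _; rewrite normrN; apply: le_trans (zC _ ed) _.
    apply: le_trans (_ : `|C| * dnorm e <= _).
      by apply: ler_wpM2r; [exact: dual_norm_ge0|exact: ler_norm].
    by rewrite mulrC; exact: ler_wpM2r.
  have ey : e y <= t ^+ 2 * `|y|.
    by apply: le_trans (dnorm_bound_le _ y ed) _; exact: ler_wpM2r.
  have eyE : e y = g' y - ((1 - t) * c y + t * f y) by [].
  have fy := dnorm_bound_le f y fd.
  have sq1 := sqr_ge0 (dnorm f - `|y|).
  have tt : t ^+ 2 <= t.
    by rewrite expr2 -[leRHS]mulr1; apply: ler_wpM2l; lra.
  have g'c : dnorm (fun x => g' x - c x) <= t * (K + 1).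
    have tfd := dual_scale t _ fcd.
    have := dual_normD _ _ ed tfd.
    have -> : (fun x => e x + t * (f x - c x)) = (fun x => g' x - c x).
      by apply/funext => x; rewrite /e /g; ring.
    have := dual_normZ_le t _ fcd; rewrite gtr0_norm// -/K; lra.
  have N1 : dnorm g' <= n + t * (K + 1).
    have := dual_normD _ _ (dual_sub _ _ g'd cd) cd.
    by under eq_fun do rewrite subrK; rewrite -/n; lra.
  have N2 : n <= dnorm g' + t * (K + 1).
    have := dual_normD _ _ (dual_sub _ _ cd g'd) g'd.
    by rewrite dual_normBC; under eq_fun do rewrite subrK; rewrite -/n; lra.
  have tK : t * (K + 1) <= K + 1 by rewrite -[leRHS]mul1r; apply: ler_wpM2r; lra.
  have yM : `|y| <= M by rewrite yn ME; lra.
  have sq2 := sqr_ge0 (dnorm g' - n).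
  have N3 : n * n <= n * (dnorm g' + t * (K + 1)) by exact: ler_wpM2l.
  have tM : t ^+ 2 * `|y| <= t * M by apply: ler_pM => //; exact: ltW.
  have ttM : t * (t * `|y|) <= t * (t * M).
    by apply: ler_wpM2l; [exact: ltW|apply: ler_wpM2l => //; exact: ltW].
  have z1 : (z f - z c) <= (f y - c y) + t * (`|C| + M).
    rewrite -(ler_pM2l t0); move: mon ze ey; rewrite eyE zg' !expr2 !(mulrDr, mulrBr).
    by move: ttM; lra.
  have CM : 0 <= t * (`|C| + M).
    by apply: mulr_ge0; [exact: ltW|apply: addr_ge0 => //; exact: le_trans yM].
  have z2 : (1 - t) * (z f - z c) <= (1 - t) * (f y - c y) + t * (`|C| + M).
    apply: le_trans (ler_wpM2l _ z1) _; first lra.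
    rewrite mulrDr lerD2l -[leRHS]mul1r; apply: ler_wpM2r => //; lra.
  (* As [g' = (1 - t) c + t f + e], the left side equals [f y - g' y + e y]. Fenchel-Young for [f],
     its equality case for [g'], and the closeness of [|g'|] to [n] give the bound. *)
  have z3 : (1 - t) * (f y - c y) <=
      2^-1 * dnorm f ^+ 2 - 2^-1 * n ^+ 2 + n * (t * (K + 1)) + t * M.
    move: Jy' tM ey fy sq1 sq2 N3; rewrite eyE !sqrrB !mulrDr yn !expr2.
    by lra.
  have z4 : t * (z f - z c) <= t * `|z f - z c|.
    by apply: ler_wpM2l; [exact: ltW|exact: ler_norm].
  by move: z2 z3 z4; rewrite BE !(mulrDr, mulrDl, mulrBr, mulrBl); lra.
apply/ler_addgt0Pr => e e0.
have B1 : 0 < `|B| + 1 by rewrite ltr_wpDl.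
pose t := Num.min (e / (`|B| + 1)) 2^-1.
have t0 : 0 < t by rewrite lt_min divr_gt0// invr_gt0 ltr0n.
have t1 : t < 1 by apply: le_lt_trans (_ : _ <= 2^-1) _; [rewrite ge_min lexx orbT|lra].
have tB : t * B <= e.
  apply: le_trans (_ : t * (`|B| + 1) <= _).
    by apply: ler_wpM2l; [exact: ltW|apply: le_trans (ler_norm B) _; rewrite lerDl].
  by rewrite -ler_pdivlMr// ge_min lexx.
by have := key t ltac:(by rewrite t0 t1); rewrite /n; lra.
Qed.

End TildeJ.

(** * The graph of [reg T l] as a contact set *)

Section Regularization.
Context {R : realType} {X : completeNormedModType R}.
Implicit Types (T : @opX R X) (f g a b : X -> R) (x y w : X) (z : (X -> R) -> R).

Lemma maximal_fitz_graph T y a : maximal_monotone T -> is_dual a ->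
  fitz_le T (embed y) a (a y) -> T (y, a).
Proof.
move=> [[Td Tm] Tmax] ad F.
have mon v b : T (v, b) -> 0 <= (a y - a v) - (b y - b v).
  by move=> Tv; have := F _ _ Tv; rewrite /embed; lra.
have <- : T `|` [set (y, a)] = T; last by right.
apply: Tmax; last by left.
split=> [p [/Td//|->//]|v b v' b'].
move=> [Tv|[-> ->]] [Tv'|[-> ->]].
- exact: Tm.
- by have bd := Td _ Tv; rewrite (dualB b)// (dualB a)//; have := mon _ _ Tv; lra.
- by have bd := Td _ Tv'; rewrite (dualB b')// (dualB a)//; have := mon _ _ Tv'; lra.
- by rewrite subrr.
Qed.

Lemma reg_yosida_le T (l : R) y a : monotone_op T -> 0 <= l -> is_dual a ->
  reg T l (y, a) -> yosida_le T l y a (a y).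
Proof.
move=> Tm l0 ad [[-> Ty]|[lp [_ [z /= [zd [[_ [_ zT]] zJ]]]]]].
  exists (embed y), (a y), 0, 0; split; last by rewrite !addr0.
  split; [exact: embed_bidual|exact: fitz_le_graph| |].
  - by move=> f fd; rewrite /embed; lra.
  - by move=> x; lra.
pose D f := z f - f y.
have sub f : is_dual f -> D f - D (fun x => - (l * a x)) <=
    2^-1 * dnorm f ^+ 2 - 2^-1 * dnorm (fun x => - (l * a x)) ^+ 2.
  exact: tilde_Jdual_subgradient.
have [Dd [cd _]] := zJ; rewrite /= -/D in Dd cd.
have Dc : D (fun x => - (l * a x)) = - (l * D a).
  rewrite (bidualN D)//; last exact: dual_scale.
  by rewrite (bidualZ D).
pose N := dnorm (fun x => - (l * a x)).
(* The value of [s] is read off the subgradient inequality at [- l f], divided by [l]. The three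
   bounds then sum to at most [a y] because [l |a| <= N]. *)
exists z, (z a), (- D a - N ^+ 2 / (2 * l)), (l / 2 * dnorm a ^+ 2).
have na : l * dnorm a <= N.
  have := dual_normZ_le (- l^-1) _ cd; rewrite normrN ger0_norm ?invr_ge0//.
  have -> : (fun x => - l^-1 * - (l * a x)) = a.
    by apply/funext => x; rewrite mulrNN mulrA mulVf ?mul1r// gt_eqF.
  by rewrite ler_pdivlMl.
have n0 := dual_norm_ge0 _ ad.
split; last first.
  have : l / 2 * dnorm a ^+ 2 <= N ^+ 2 / (2 * l).
    have -> : l / 2 * dnorm a ^+ 2 = (l * dnorm a) ^+ 2 / (2 * l) by field; rewrite gt_eqF.
    apply: ler_wpM2r; first by rewrite invr_ge0 mulr_ge0.
    by rewrite lerXn2r ?nnegrE ?mulr_ge0//; apply: le_trans na; rewrite mulr_ge0.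
  by rewrite /D; lra.
split=> //.
- move=> w b Tw; have bd : is_dual b := Tm.1 _ Tw.
  by have /= := zT _ _ Tw; rewrite (bidualB z)//; lra.
- move=> f fd; have lfd := dual_scale (- l) f fd.
  have := sub _ lfd; rewrite Dc (bidualZ D)// -/N => H.
  have H' : dnorm (fun x => - l * f x) ^+ 2 <= (l * dnorm f) ^+ 2.
    have := dual_normZ_le (- l) _ fd; rewrite normrN ger0_norm// => h.
    by rewrite lerXn2r ?nnegrE ?dual_norm_ge0// mulr_ge0// dual_norm_ge0.
  rewrite -(ler_pM2l lp).
  have -> : l * (l / 2 * dnorm f ^+ 2 + (- D a - N ^+ 2 / (2 * l))) =
    2^-1 * (l * dnorm f) ^+ 2 - l * D a - 2^-1 * N ^+ 2 by field; rewrite gt_eqF.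
  by move: H H'; rewrite /D; lra.
- by apply/dquad_leP.
Qed.

(** A total of [a y] forces equality in each inequality behind [yosida_ge]. Equality in the
    Fitzpatrick bound says that [(z, a)] is in [tilde T]; equality in the quadratic bounds gives the
    inclusion for the duality mapping. *)
Lemma yosida_le_reg T (l : R) y a : maximal_monotone T -> negative_infimum T -> 0 <= l ->
  is_dual a -> yosida_le T l y a (a y) -> reg T l (y, a).
Proof.
move=> Tmax TN l0 ad [z [r [s [q [[zd zr zs aq] le]]]]].
have Td : dual_op T := Tmax.1.1.
have za := fitz_ge _ _ _ _ Td TN zd ad zr.
have := zs _ ad; have aq' := iffLR (dquad_leP _ _ _ l0 ad) aq => zsa.
have ra : r = z a by lra.
have [l_eq0|l_neq0] := eqVneq l 0.
  left; split=> //; apply: maximal_fitz_graph => //.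
  (* For [l = 0] the quadratic bound is the constant [s] along all multiples of [f], so [z]
     coincides with [embed y] on the dual. *)
  have zE f : is_dual f -> f y - z f = 0.
    move=> fd; apply: (@bounded_multiples_eq0 _ _ s) => t.
    have := zs _ (dual_scale t f fd); rewrite (bidualZ z)// l_eq0; lra.
  move=> w b Tw; have bd : is_dual b := Td _ Tw.
  have := zr _ _ Tw; have := zE _ bd; have := zE _ ad; rewrite /embed; lra.
have lp : 0 < l by rewrite lt_def l_neq0.
right; split=> //; split=> //; exists z; split=> //; split.
  split=> //; split=> // w b Tw /=; have bd : is_dual b := Td _ Tw.
  by have := zr _ _ Tw; rewrite (bidualB z)//; lra.
have Dd := bidual_sub _ _ zd (embed_bidual y).
have lad := dual_opp _ (dual_scale l a ad).
split=> //; split=> //= v k Jv; have kd : is_dual k by case: Jv.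
rewrite (bidualB z)// (bidualN z) ?(bidualZ z)//; last exact: dual_scale.
have := iffLR (JdualP _ _ kd) Jv.
(* The test at [- k / l] turns [quad_le] into [z k - k y <= |k|^2 / 2 + l s], to be compared with
   the Fenchel equality for [(v, k)]. *)
have := zs _ (dual_scale (- l^-1) k kd); rewrite (bidualZ z)//.
have kn : l / 2 * dnorm (fun x => - l^-1 * k x) ^+ 2 <= (2 * l)^-1 * dnorm k ^+ 2.
  have := dual_normZ_le (- l^-1) _ kd; rewrite normrN ger0_norm ?invr_ge0// => h.
  have -> : (2 * l)^-1 * dnorm k ^+ 2 = l / 2 * (l^-1 * dnorm k) ^+ 2 by field.
  apply: ler_wpM2l; first by rewrite divr_ge0.
  rewrite lerXn2r ?nnegrE//; first by apply: dual_norm_ge0; exact: dual_scale.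
  by rewrite mulr_ge0 ?invr_ge0// dual_norm_ge0.
move=> H Jk.
have {}H : l * (- l^-1 * k y - - l^-1 * z k) <= l * ((2 * l)^-1 * dnorm k ^+ 2 + s).
  by apply: ler_wpM2l => //; apply: le_trans H _; rewrite lerD2r.
have E1 : l * (- l^-1 * k y - - l^-1 * z k) = z k - k y by field.
have E2 : l * ((2 * l)^-1 * dnorm k ^+ 2 + s) = 2^-1 * dnorm k ^+ 2 + l * s by field.
rewrite {}E1 {}E2 in H.
have av := dnorm_bound a v ad; rewrite ler_norml in av; case/andP: av => av _.
have lav : l * - (dnorm a * `|v|) <= l * a v by exact: ler_wpM2l.
have sq := sqr_ge0 (l * dnorm a - `|v|); rewrite sqrrB in sq.
have ls : l * (a y - z a) = l * (l / 2 * dnorm a ^+ 2 + s).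
  by congr (_ * _); lra.
by move: ls lav sq; rewrite !(mulrDr, mulrBr, exprMn) !expr2; lra.
Qed.

End Regularization.

(** * From closed convex epigraphs to representability *)

Section Representability.
Context {R : realType} {X : normedModType R}.

(** Closedness makes the infimum defining [h] attained, so [h <= r] is equivalent to [E]; lower
    semicontinuity, convexity and the contact set can then all be read off [E]. *)
Lemma representable_of_epi (E : X -> (X -> R) -> R -> Prop) (T : @opX R X) :
  (exists x f r, is_dual f /\ E x f r) ->
  (forall x f r x' f' r' (t : R), is_dual f -> is_dual f' -> 0 < t < 1 ->
     E x f r -> E x' f' r' ->
     E (t *: x + (1 - t) *: x') (fun v => t * f v + (1 - t) * f' v) (t * r + (1 - t) * r')) ->
  (forall x f r, is_dual f ->
     (forall e : R, 0 < e -> exists y g s, [/\ is_dual g, E y g s, `|y - x| < e,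
        dnorm (fun v => g v - f v) < e & s < r + e]) -> E x f r) ->
  (forall x f r, is_dual f -> E x f r -> f x <= r) ->
  (forall x f, T (x, f) <-> is_dual f /\ E x f (f x)) ->
  representable T.
Proof.
move=> [x0 [f0 [r0 [f0d E0]]]] Econv Eclosed Ege TE.
have dn0 (f : X -> R) : dnorm (fun v => f v - f v) <= 0.
  by apply: dnorm_le => // v; rewrite subrr normr0 mul0r.
pose h (p : X * (X -> R)) := ereal_inf [set r%:E | r in E p.1 p.2].
have hP x f r : is_dual f -> (h (x, f) <= r%:E)%E <-> E x f r.
  move=> fd; split=> [hr|Er]; last by apply: ereal_inf_lbound; exists r.
  apply: Eclosed => // e e0.
  have /ereal_inf_lt[_ [s Es <-]] : (h (x, f) < (r + e)%:E)%E.
    by apply: le_lt_trans hr _; rewrite lte_fin ltrDl.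
  rewrite lte_fin => sr; exists x, f, s; split=> //; first by rewrite subrr normr0.
  exact: le_lt_trans (dn0 f) e0.
have hge x f : is_dual f -> ((f x)%:E <= h (x, f))%E.
  by move=> fd; apply/ereal_infP => _ [r Er <-]; rewrite lee_fin; exact: Ege.
have hnoo x f : is_dual f -> h (x, f) != -oo%E.
  by move=> fd; apply: contraTneq (hge x f fd) => ->; rewrite leNgt ltNyr.
exists h; split; first by case=> x f; exact: hnoo.
split.
  by exists (x0, f0); split=> //; apply: le_lt_trans (iffRL (hP _ _ _ f0d) E0) (ltry _).
split.
  move=> x1 f1 x2 f2 t f1d f2d t01; have /andP[t0 t1] := t01.
  have t1' : 0 < 1 - t by rewrite subr_gt0.
  have := hnoo x1 f1 f1d; have := hnoo x2 f2 f2d.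
  case h1E : (h (x1, f1)) => [r1| |]//; case h2E : (h (x2, f2)) => [r2| |]// _ _.
  - rewrite -!EFinM -EFinD; apply/hP; first exact: dual_lincomb.
    by apply: Econv => //; apply/hP => //; rewrite ?h1E ?h2E.
  - by rewrite gt0_muley ?lte_fin// addeC -EFinM leey.
  - by rewrite gt0_muley ?lte_fin// -EFinM leey.
  - by rewrite !gt0_muley ?lte_fin// leey.
split.
  move=> x f fd t th; apply: contrapT => nlsc.
  suff /(hP _ _ _ fd) : E x f t by rewrite leNgt th.
  apply: Eclosed => // e e0; apply: contrapT => nE; apply: nlsc.
  exists e; split=> // y g gd ye ge; rewrite ltNge; apply/negP => /(hP _ _ _ gd) Et.
  by apply: nE; exists y, g, t; split=> //; rewrite ltrDl.
split; first exact: hge.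
apply/seteqP; split=> [[x f] /TE[fd Ef]|[x f] /= [fd hE]].
  by split=> //=; apply/le_anti; rewrite hge// andbT; exact/hP.
by apply/TE; split=> //; apply/hP => //; rewrite hE.
Qed.

Lemma pairing_near (x y : X) f g (e : R) : is_dual f -> is_dual g -> e <= 1 ->
  `|y - x| < e -> dnorm (fun v => g v - f v) < e ->
  `|g y - f x| <= e * (`|x| + 1 + dnorm f).
Proof.
move=> fd gd e1 yx gf.
have gfd := dual_sub _ _ gd fd.
have e0 : 0 <= e by apply: le_trans (ltW yx).
have h1 := dnorm_bound _ y gfd; have h2 := dnorm_bound _ (y - x) fd.
rewrite (dualB f)// in h2.
have yb : `|y| <= `|x| + 1.
  by have := ler_normD (y - x) x; rewrite subrK; lra.
have h3 : dnorm (fun v => g v - f v) * `|y| <= e * (`|x| + 1).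
  by apply: ler_pM => //; [exact: dual_norm_ge0|exact: ltW].
have h4 : dnorm f * `|y - x| <= dnorm f * e.
  by apply: ler_wpM2l; [exact: dual_norm_ge0|exact: ltW].
have -> : g y - f x = (g y - f y) + (f y - f x) by rewrite addrA subrK.
apply: le_trans (ler_normD _ _) _; rewrite mulrDr [e * dnorm f]mulrC.
by apply: lerD; [exact: le_trans h1 h3|exact: le_trans h2 h4].
Qed.

End Representability.

(** * Representability of the variational sum *)

Section VariationalSum.
Context {R : realType} {X : completeNormedModType R} {T1 T2 : @opX R X}.
Context (D1 : typeD T1) (D2 : typeD T2).
Let max1 : maximal_monotone T1 := D1.1.
Let max2 : maximal_monotone T2 := D2.1.
Let mon1 : monotone_op T1 := D1.1.1.
Let mon2 : monotone_op T2 := D2.1.1.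
Let NI1 : negative_infimum T1 := typeD_negative_infimum _ D1.
Let NI2 : negative_infimum T2 := typeD_negative_infimum _ D2.
Implicit Types (f g : X -> R) (x y : X).

Lemma reg_dual (T : @opX R X) (l : R) y a : dual_op T -> reg T l (y, a) -> is_dual a.
Proof. by move=> Td [[_ /Td//]|[_ []]]. Qed.

Lemma opsum_sum_le (l m : R) y g : 0 <= l -> 0 <= m ->
  opsum (reg T1 l) (reg T2 m) (y, g) -> is_dual g /\ sum_le T1 T2 l m y g (g y).
Proof.
move=> l0 m0 [a1 [a2 [/= S1 [S2 ->]]]].
have ad1 := reg_dual _ _ _ _ mon1.1 S1; have ad2 := reg_dual _ _ _ _ mon2.1 S2.
split; first exact: dual_add.
by exists a1, a2, (a1 y), (a2 y); split=> //; exact: reg_yosida_le.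
Qed.

(** Each of the two values dominates its own pairing, so equality for the total forces equality in
    both. *)
Lemma sum_le_opsum (l m : R) y g : 0 <= l -> 0 <= m ->
  sum_le T1 T2 l m y g (g y) -> opsum (reg T1 l) (reg T2 m) (y, g).
Proof.
move=> l0 m0 [a1 [a2 [c1 [c2 [[ad1 ad2] gE Y1 Y2 le]]]]].
have g1 := yosida_ge _ _ _ _ _ l0 mon1.1 NI1 ad1 Y1.
have g2 := yosida_ge _ _ _ _ _ m0 mon2.1 NI2 ad2 Y2.
have [e1 e2] : c1 = a1 y /\ c2 = a2 y.
  by move: le; rewrite gE => le; split; apply/le_anti/andP; split; lra.
exists a1, a2; split; last split=> //=.
- by apply: yosida_le_reg => //; rewrite -e1.
- by apply: yosida_le_reg => //; rewrite -e2.
Qed.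

(** [liminf_op] asks for a point at every index, including the early ones where nothing near the
    target is known to exist. *)
Lemma opsum_reg_nonempty (l m : R) : 0 <= l -> 0 <= m -> 0 < l + m ->
  exists y g, is_dual g /\ opsum (reg T1 l) (reg T2 m) (y, g).
Proof.
move=> l0 m0 lm.
have [y [g [c [gd S _]]]] := @sum_approx R X T1 T2 l m (fun=> 0) 0 l0 m0 lm
  mon1 NI1 mon2 NI2 is_dual0 1 ltr01.
(* Adding 1 makes [e] at least 1, so [e ^+ 2] exceeds the gap, whatever its size. *)
pose e := `|c - g y| + 1; have e0 : 0 < e by rewrite ltr_wpDl.
have ce : c <= g y + e ^+ 2.
  have := ler_norm (c - g y); have := normr_ge0 (c - g y).
  by have := sqr_ge0 `|c - g y|; rewrite /e sqrrD1; lra.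
have [y' [g' [g'd S' _ _]]] := sum_exact_near l0 m0 lm mon1 NI1 mon2 NI2 _ _ _ _ gd S e0 ce.
by exists y', g'; split=> //; exact: sum_le_opsum.
Qed.

(* Epigraph of the supremum over all admissible sequences of the upper
   epi-limits of [sum_le T1 T2 (l n) (m n)]. *)
Definition var_sum_epi x f (r : R) : Prop :=
  forall l m, admissible l m -> forall e : R, 0 < e -> exists N, forall n, (N <= n)%N ->
    exists y g s, [/\ is_dual g, sum_le T1 T2 (l n) (m n) y g s, `|y - x| < e,
      dnorm (fun v => g v - f v) < e & s < r + e].

Lemma var_sum_epi_convex x f r x' f' r' (t : R) : is_dual f -> is_dual f' -> 0 < t < 1 ->
  var_sum_epi x f r -> var_sum_epi x' f' r' ->
  var_sum_epi (t *: x + (1 - t) *: x') (fun v => t * f v + (1 - t) * f' v)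
    (t * r + (1 - t) * r').
Proof.
move=> fd f'd t01 E E' l m adm e e0; have /andP[t0 t1] := t01.
have t1' : 0 < 1 - t by rewrite subr_gt0.
have [N HN] := E l m adm e e0; have [N' HN'] := E' l m adm e e0.
have [lm0 _] := adm.
exists (maxn N N') => n; rewrite geq_max => /andP[/HN + /HN'].
move=> [y [g [s [gd S ye ge sr]]]] [y' [g' [s' [g'd S' ye' ge' sr']]]].
have [l0 [m0 _]] := lm0 n.
have conv_lt (A B C D : R) : A < B -> C < D -> t * A + (1 - t) * C < t * B + (1 - t) * D.
  by move=> AB CD; apply: ltrD; rewrite ltr_pM2l.
exists (t *: y + (1 - t) *: y'), (fun v => t * g v + (1 - t) * g' v), (t * s + (1 - t) * s').
split; first exact: dual_lincomb.
- exact: sum_convex.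
- have -> : t *: y + (1 - t) *: y' - (t *: x + (1 - t) *: x') =
      t *: (y - x) + (1 - t) *: (y' - x') by rewrite opprD addrACA -!scalerBr.
  apply: le_lt_trans (normr_conv _ _ _ t01) _.
  by apply: lt_le_trans (conv_lt _ _ _ _ ye ye') _; lra.
- have -> : (fun v => t * g v + (1 - t) * g' v - (t * f v + (1 - t) * f' v)) =
      (fun v => t * (g v - f v) + (1 - t) * (g' v - f' v)) by apply/funext => v; ring.
  apply: le_lt_trans (dnorm_lincomb _ _ _ _ (dual_sub _ _ gd fd) (dual_sub _ _ g'd f'd)) _.
  rewrite !gtr0_norm//.
  by apply: lt_le_trans (conv_lt _ _ _ _ ge ge') _; lra.
- by apply: lt_le_trans (conv_lt _ _ _ _ sr sr') _; lra.
Qed.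

Lemma var_sum_epi_closed x f r : is_dual f ->
  (forall e : R, 0 < e -> exists y g s, [/\ is_dual g, var_sum_epi y g s, `|y - x| < e,
     dnorm (fun v => g v - f v) < e & s < r + e]) -> var_sum_epi x f r.
Proof.
move=> fd H l m adm e e0; have e2 : 0 < e / 2 by rewrite divr_gt0.
have [y [g [s [gd E ye ge sr]]]] := H _ e2.
have [N HN] := E l m adm _ e2.
exists N => n /HN[y' [g' [s' [g'd S ye' ge' sr']]]].
exists y', g', s'; split=> //; last by lra.
- by have := ler_normD (y' - y) (y - x); rewrite addrA subrK; lra.
- by have := dnorm_triangle _ _ _ g'd gd fd; lra.
Qed.

Lemma harmonic_admissible :
  admissible (fun n => n.+1%:R^-1 : R) (fun n => n.+1%:R^-1 : R).
Proof.
split; last by split; exact: cvg_harmonic.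
by move=> n; rewrite !invr_ge0 !ler0n; split=> //; split=> //; rewrite addr_gt0// invr_gt0 ltr0n.
Qed.

Lemma var_sum_epi_ge x f r : is_dual f -> var_sum_epi x f r -> f x <= r.
Proof.
move=> fd E; pose K := `|x| + 1 + dnorm f + 1.
have K0 : 0 < K by have := dual_norm_ge0 f fd; have := normr_ge0 x; rewrite /K; lra.
apply/ler_addgt0Pr => e e0.
pose d := Num.min (e / K) 1.
have d0 : 0 < d by rewrite lt_min divr_gt0// ltr01.
have d1 : d <= 1 by rewrite ge_min lexx orbT.
have dK : d * K <= e by rewrite -ler_pdivlMr// ge_min lexx.
have [N /(_ N (leqnn N))] := E _ _ harmonic_admissible d d0.
move=> [y [g [s [gd S ye ge sr]]]].
have n0 : 0 <= N.+1%:R^-1 :> R by rewrite invr_ge0.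
have gs := sum_ge _ _ _ _ _ _ _ n0 n0 mon1.1 NI1 mon2.1 NI2 S.
have := pairing_near _ _ _ _ _ fd gd d1 ye ge; rewrite ler_norml => /andP[h _].
by move: dK; rewrite /K (mulrDr d _ 1); lra.
Qed.

Lemma var_sum_sub_epi x f : var_sum T1 T2 (x, f) -> is_dual f /\ var_sum_epi x f (f x).
Proof.
move=> V; have fd : is_dual f by have [] := V _ _ harmonic_admissible.
split=> // l m adm e e0; have [_ [y [g [/= S [yx gf]]]]] := V _ _ adm.
have [lm0 _] := adm.
pose K := `|x| + 1 + dnorm f.
have K0 : 0 < K by have := dual_norm_ge0 f fd; have := normr_ge0 x; rewrite /K; lra.
pose d := Num.min (e / (K + 1)) (Num.min e 1).
have K1 : 0 < K + 1 by lra.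
have d0 : 0 < d by rewrite !lt_min divr_gt0// e0 ltr01.
have d1 : d <= 1 by rewrite !ge_min lexx !orbT.
have de : d <= e by rewrite !ge_min lexx !orbT.
have dK : d * (K + 1) <= e by rewrite -ler_pdivlMr// ge_min lexx.
have /cvgrPdist_lt /(_ d d0) [N1 _ H1] := yx.
have /cvgrPdist_lt /(_ d d0) [N2 _ H2] := gf.
exists (maxn N1 N2) => n; rewrite geq_max => /andP[/H1/= h1 /H2/= h2].
have [l0 [m0 _]] := lm0 n.
have [gd Sn] := opsum_sum_le _ _ _ _ l0 m0 (S n).
have h1' : `|y n - x| < d by rewrite distrC.
have h2' : dnorm (fun v => g n v - f v) < d.
  by apply: le_lt_trans h2; rewrite sub0r normrN ler_norm.
exists (y n), (g n), (g n (y n)); split=> //.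
- exact: lt_le_trans de.
- exact: lt_le_trans de.
have := pairing_near _ _ _ _ _ fd gd d1 h1' h2'; rewrite ler_norml -/K => /andP[_ h].
by move: dK; rewrite mulrDr mulr1; lra.
Qed.

Lemma var_sum_epi_near x f l m : is_dual f -> var_sum_epi x f (f x) -> admissible l m ->
  forall d : R, 0 < d -> exists N, forall n, (N <= n)%N -> exists y g,
    [/\ is_dual g, opsum (reg T1 (l n)) (reg T2 (m n)) (y, g), `|y - x| < d &
      dnorm (fun v => g v - f v) < d].
Proof.
move=> fd E adm d d0; have [lm0 _] := adm.
(* The recovery point is within [k <= e] of the target and the exact point within [6 e] of it, a
   total of [7 e < d]. The choice of [k] makes the gap at the recovery point at most [e ^+ 2]. *)
pose e := d / 8; have e0 : 0 < e by rewrite /e; lra.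
pose K := `|x| + 1 + dnorm f.
have K0 : 0 < K by have := dual_norm_ge0 f fd; have := normr_ge0 x; rewrite /K; lra.
pose k := Num.min (e ^+ 2 / (K + 1)) (Num.min e 1).
have K1 : 0 < K + 1 by lra.
have k0 : 0 < k by rewrite !lt_min divr_gt0 ?exprn_gt0// e0 ltr01.
have k1 : k <= 1 by rewrite !ge_min lexx !orbT.
have ke : k <= e by rewrite !ge_min lexx !orbT.
have kK : k * (K + 1) <= e ^+ 2 by rewrite -ler_pdivlMr// ge_min lexx.
have [N HN] := E l m adm k k0.
exists N => n /HN[y [g [s [gd S ye ge sr]]]].
have [l0 [m0 lm]] := lm0 n.
have sg : s <= g y + e ^+ 2.
  have := pairing_near _ _ _ _ _ fd gd k1 ye ge; rewrite ler_norml -/K => /andP[h _].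
  by move: kK; rewrite mulrDr mulr1; lra.
have [y' [g' [g'd S' h1 h2]]] := sum_exact_near l0 m0 lm mon1 NI1 mon2 NI2 _ _ _ _ gd S e0 sg.
have d8 : d = 8 * e by rewrite /e; field.
exists y', g'; split=> //; first exact: sum_le_opsum.
- by have := ler_normD (y' - y) (y - x); rewrite addrA subrK; lra.
- by have := dnorm_triangle _ _ _ g'd gd fd; lra.
Qed.

(** [var_sum_epi_near] gives, for each tolerance, points from some index on. Choosing at every index
    a point whose distance is within [1 / (n + 1)] of the infimum merges these into one sequence. *)
Lemma var_sum_of_epi x f : is_dual f -> var_sum_epi x f (f x) -> var_sum T1 T2 (x, f).
Proof.
move=> fd E l m adm; split=> //; have [lm0 _] := adm.
pose S n := opsum (reg T1 (l n)) (reg T2 (m n)).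
pose dist (p : X * (X -> R)) := `|p.1 - x| + dnorm (fun v => p.2 v - f v).
pose A n := [set dist p | p in [set p | is_dual p.2 /\ S n p]].
have dist_ge0 p : is_dual p.2 -> 0 <= dist p.
  by move=> pd; apply: addr_ge0 => //; apply: dual_norm_ge0; exact: dual_sub.
have infA n : has_inf (A n).
  have [l0 [m0 lm]] := lm0 n; have [y [g [gd Sg]]] := opsum_reg_nonempty _ _ l0 m0 lm.
  split; first by exists (dist (y, g)), (y, g).
  by exists 0 => _ [p [pd _] <-]; exact: dist_ge0.
have /choice[P PP] n : exists p, [/\ is_dual p.2, S n p & dist p < inf (A n) + n.+1%:R^-1].
  have n0 : 0 < n.+1%:R^-1 :> R by rewrite invr_gt0.
  by have [_ [p [pd Sp] <-] lt] := inf_adherent n0 (infA n); exists p.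
have near0 (e : R) : 0 < e -> (\forall n \near \oo, dist (P n) < e).
  move=> e0; have e4 : 0 < e / 4 by rewrite divr_gt0.
  have [N HN] := var_sum_epi_near _ _ _ _ fd E adm _ e4.
  have /cvgrPdist_lt /(_ _ e4) [N' _ HN'] := @cvg_harmonic R.
  exists (maxn N N') => // n /=; rewrite geq_max => /andP[/HN + /HN'].
  move=> [y [g [gd Sg h1 h2]]] /=; rewrite sub0r normrN ger0_norm ?invr_ge0// => h3.
  have [_ _ h4] := PP n.
  have h5 : inf (A n) <= dist (y, g).
    by apply: ge_inf; [case: (infA n)|exists (y, g)].
  have h6 : dist (P n) < inf (A n) + e / 4.
    by apply: lt_trans h4 _; rewrite ltrD2l.
  by move: h5; rewrite {1}/dist /=; lra.
exists (fun n => (P n).1), (fun n => (P n).2); split=> [n|].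
  by have [_ + _] := PP n; rewrite -surjective_pairing.
split; apply/cvgrPdist_lt => e /near0; apply: filterS => n; rewrite /dist => h.
- rewrite distrC; apply: le_lt_trans h; rewrite lerDl; apply: dual_norm_ge0.
  by apply: dual_sub => //; have [] := PP n.
- rewrite sub0r normrN ger0_norm; last first.
    by apply: dual_norm_ge0; apply: dual_sub => //; have [] := PP n.
  by apply: le_lt_trans h; rewrite lerDr.
Qed.

Lemma var_sum_representable : representable (var_sum T1 T2).
Proof.
(* An element of the sum is what makes [var_sum_epi] proper. *)
have [[[x f] Vx]|Vempty] := pselect (exists p, var_sum T1 T2 p).
  have [fd Ex] := var_sum_sub_epi _ _ Vx.
  apply: (@representable_of_epi R X var_sum_epi).
  - by exists x, f, (f x).
  - by move=> *; exact: var_sum_epi_convex.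
  - by move=> *; exact: var_sum_epi_closed.
  - by move=> *; exact: var_sum_epi_ge.
  - move=> y g; split; first exact: var_sum_sub_epi.
    by move=> [gd Eg]; exact: var_sum_of_epi.
(* If the variational sum is empty, any representative function shifted by
   [1] lies strictly above the pairing. *)
have lm : 0 < 1 + 1 :> R by lra.
apply: (@representable_of_epi R X (fun x f r => sum_le T1 T2 1 1 x f (r - 1))).
- have [y [g [c [gd S _]]]] := @sum_approx R X T1 T2 1 1 (fun=> 0) 0 ler01 ler01 lm
    mon1 NI1 mon2 NI2 is_dual0 1 ltr01.
  by exists y, g, (c + 1); rewrite addrK.
- move=> x f r x' f' r' t fd f'd t01 S S'.
  have -> : t * r + (1 - t) * r' - 1 = t * (r - 1) + (1 - t) * (r' - 1) by ring.
  exact: sum_convex.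
- move=> x f r fd H; apply: sum_closed => //.
  + exact: mon1.1.
  + exact: negative_infimum_nonempty.
  + exact: mon2.1.
  + exact: negative_infimum_nonempty.
  move=> e e0; have [y [g [s [gd S ye ge sr]]]] := H e e0.
  by exists y, g, (s - 1); split=> //; lra.
- move=> x f r fd /(sum_ge _ _ _ _ _ _ _ ler01 ler01 mon1.1 NI1 mon2.1 NI2); lra.
- move=> x f; split=> [Vx|[_]]; first by case: Vempty; exists (x, f).
  by move=> /(sum_ge _ _ _ _ _ _ _ ler01 ler01 mon1.1 NI1 mon2.1 NI2); lra.
Qed.

End VariationalSum.

Theorem theorem4p2 (R : realType) (X : completeNormedModType R)
  (T1 T2 : set (X * (X -> R))) :
  typeD T1 -> typeD T2 -> representable (var_sum T1 T2).
Proof. exact: var_sum_representable. Qed.
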